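(* Every $3$-quasi-Sasakian manifold $(M,\phi_\delta,\xi_\delta,\eta_\delta,g)$, $\delta\in\{1,2,3\}$, of dimension $4n+3$ and of maximal rank (i.e. rank $4n+3$) is $3$-$\alpha$-Sasakian.
   Context: Conventions: for a $1$-form $\eta$, $2d\eta(X,Y)=X(\eta(Y))-Y(\eta(X))-\eta([X,Y])$. An almost contact metric structure $(\phi,\xi,\eta,g)$ consists of a $(1,1)$-tensor $\phi$, a vector field $\xi$, a $1$-form $\eta$ and a Riemannian metric $g$ with $\phi^2=-I+\eta\otimes\xi$, $\eta(\xi)=1$, $g(\phi X,\phi Y)=g(X,Y)-\eta(X)\eta(Y)$. Its fundamental $2$-form is $\Phi(X,Y)=g(X,\phi Y)$. It is normal if $[\phi,\phi]+2d\eta\otimes\xi=0$ ($[\phi,\phi]$ the Nijenhuis torsion), quasi-Sasakian if it is normal and $d\Phi=0$, and $\alpha$-Sasakian, for a real constant $\alpha\ne0$, if it is normal and $d\eta=\alpha\Phi$. A quasi-Sasakian structure has rank $2p+1$ if $\eta\wedge(d\eta)^p\neq0$ and $(d\eta)^{p+1}=0$ on $M$; only structures of constant rank are considered. An almost $3$-contact metric manifold is a $(4n+3)$-dimensional manifold with three almost contact metric structures $(\phi_\delta,\xi_\delta,\eta_\delta,g)$, $\delta=1,2,3$, with the same metric $g$, such that for every even permutation $(\alpha,\beta,\gamma)$ of $\{1,2,3\}$: $\phi_\gamma=\phi_\alpha\phi_\beta-\eta_\beta\otimes\xi_\alpha=-\phi_\beta\phi_\alpha+\eta_\alpha\otimes\xi_\beta$,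 $\xi_\gamma=\phi_\alpha\xi_\beta=-\phi_\beta\xi_\alpha$, $\eta_\gamma=\eta_\alpha\circ\phi_\beta=-\eta_\beta\circ\phi_\alpha$. It is $3$-quasi-Sasakian if each of the three structures is quasi-Sasakian; it is $3$-$\alpha$-Sasakian if each of the three structures is $\alpha$-Sasakian (with the same real constant $\alpha\neq0$). On a $3$-quasi-Sasakian manifold it is known that $\eta_1,\eta_2,\eta_3$ have the same rank, called the rank of $M$.
   Formalization: The manifold M is assumed connected; otherwise the claim fails, e.g. for a disjoint union of two 3-α-Sasakian spheres with different constants α. *)

(* Defs.v *)
From HB Require Import structures.
From mathcomp Require Import all_boot all_order all_algebra all_fingroup.
From mathcomp Require Import all_classical all_reals all_analysis ring.

Set Implicit Arguments.
Unset Strict Implicit.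
Unset Printing Implicit Defensive.

Import Order.TTheory GRing.Theory Num.Theory.
Import numFieldNormedType.Exports.

Local Open Scope classical_set_scope.
Local Open Scope ring_scope.

Lemma near_eq_differentiable (R : realType) (V W : normedModType R)
    (f g : V -> W) (x : V) :
  (\near x, f x = g x) -> differentiable f x -> differentiable g x.
Proof.
move=> fg df; have fgx : f x = g x by exact: nbhs_singleton fg.
have eg : g \o shift x = cst (g x) + 'd f x +o_ 0 id.
  apply/eqaddoP => e e0; have /eqaddoP/(_ e e0) := diff_locally df.
  have : \forall y \near 0, f (y + x) = g (y + x).
    by move: fg; rewrite (near_shift 0) subr0.
  apply: filterS2 => y fgy.
  by rewrite !fctE /= fgy fgx.
apply/diff_locallyP; rewrite (diff_unique (diff_continuous df) eg).
by split; [exact: diff_continuous|exact: eg].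
Qed.

(* C^oo functions on an open set [U]: every iterated directional derivative
   (the empty iteration included) is Frechet differentiable at every point of
   [U].  Functions are total; their values outside [U] are irrelevant. *)
Section smooth_on.
Variables (R : realType) (m : nat).
Local Notation V := 'rV[R]_m.
Implicit Types (U : set V) (f g : V -> R) (vs : seq V).

Definition iter_derive vs f : V -> R := foldr (fun v h => 'D_v h) f vs.

Definition smooth_on U f :=
  forall vs x, U x -> differentiable (iter_derive vs f) x.

Definition smooth_upto n U f := forall vs x,
  (size vs <= n)%N -> U x -> differentiable (iter_derive vs f) x.

Fact iter_derive_eq U f g vs : open U -> {in U, f =1 g} ->
  {in U, iter_derive vs f =1 iter_derive vs g}.
Proof.
move=> oU fg; elim: vs => [//|v vs IH] /= x /set_mem xU.
apply: near_eq_derive; have : nbhs x U by apply: open_nbhs_nbhs.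
by apply: filterS => y Uy; apply: IH; exact: mem_set.
Qed.

Fact smooth_upto_eq n U f g : open U -> {in U, f =1 g} ->
  smooth_upto n U f -> smooth_upto n U g.
Proof.
move=> oU fg sf vs x nvs xU; apply: near_eq_differentiable (sf vs x nvs xU).
have : nbhs x U by apply: open_nbhs_nbhs.
by apply: filterS => y Uy; apply: (iter_derive_eq vs oU fg); exact: mem_set.
Qed.

Fact iter_derive_rcons vs v f :
  iter_derive (rcons vs v) f = iter_derive vs ('D_v f).
Proof. by rewrite /iter_derive foldr_rcons. Qed.

Fact smooth_uptoS n U f : smooth_upto n.+1 U f <->
  (forall x, U x -> differentiable f x) /\
  forall v, smooth_upto n U ('D_v f).
Proof.
split=> [sf|[df sf] vs x].
  split=> [x|v vs x nvs]; first exact: (sf [::]).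
  by rewrite -iter_derive_rcons; apply: sf; rewrite size_rcons.
case/lastP: vs => [_|vs v]; first exact: df.
by rewrite size_rcons iter_derive_rcons; exact: sf.
Qed.

Fact smooth_uptoW n U f : smooth_upto n.+1 U f -> smooth_upto n U f.
Proof. by move=> sf vs x nvs; apply: sf; exact: leqW. Qed.

Fact smooth_upto0 U f : smooth_upto 0 U f <->
  (forall x, U x -> differentiable f x).
Proof.
by split=> [sf x|df [|//] x _]; [exact: (sf [::])|exact: df].
Qed.

Fact smooth_uptoD n U f g : open U ->
  smooth_upto n U f -> smooth_upto n U g -> smooth_upto n U (f + g).
Proof.
move=> oU; elim: n f g => [|n IH] f g.
  move=> /smooth_upto0 df /smooth_upto0 dg; apply/smooth_upto0 => x xU.
  by apply: differentiableD; [exact: df|exact: dg].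
move=> /smooth_uptoS[df sf] /smooth_uptoS[dg sg]; apply/smooth_uptoS.
split=> [x xU|v]; first by apply: differentiableD; [exact: df|exact: dg].
apply: (smooth_upto_eq oU _ (IH _ _ (sf v) (sg v))) => x /set_mem xU.
by rewrite deriveD//; apply: diff_derivable; [exact: df|exact: dg].
Qed.

Fact smooth_uptoM n U f g : open U ->
  smooth_upto n U f -> smooth_upto n U g -> smooth_upto n U (f * g).
Proof.
move=> oU; elim: n f g => [|n IH] f g.
  move=> /smooth_upto0 df /smooth_upto0 dg; apply/smooth_upto0 => x xU.
  by apply: differentiableM; [exact: df|exact: dg].
move=> sf1 sg1; have sfn := smooth_uptoW sf1; have sgn := smooth_uptoW sg1.
move: sf1 sg1 => /smooth_uptoS[df sf] /smooth_uptoS[dg sg]; apply/smooth_uptoS.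
split=> [x xU|v]; first by apply: differentiableM; [exact: df|exact: dg].
apply: (smooth_upto_eq oU _
  (smooth_uptoD oU (IH _ _ sfn (sg v)) (IH _ _ sgn (sf v)))) => x /set_mem xU.
by rewrite deriveM//; apply: diff_derivable; [exact: df|exact: dg].
Qed.

Lemma smooth_on_cst U (c : R) : smooth_on U (cst c).
Proof.
have dc d x : differentiable (cst d : V -> R) x.
  exact: differentiable_cst.
move=> vs x _; suff [d ->] : exists d, iter_derive vs (cst c) = cst d by [].
elim: vs => [|v vs [d IH]] /=; first by exists c.
by exists 0; rewrite IH; apply/funext => y; rewrite derive_cst.
Qed.

Lemma smooth_onD U f g :
  open U -> smooth_on U f -> smooth_on U g -> smooth_on U (f + g).
Proof.
by move=> oU sf sg vs x; apply: (@smooth_uptoD (size vs) _ _ _ oU) => // ws y _;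
  [exact: sf|exact: sg].
Qed.

Lemma smooth_onM U f g :
  open U -> smooth_on U f -> smooth_on U g -> smooth_on U (f * g).
Proof.
by move=> oU sf sg vs x; apply: (@smooth_uptoM (size vs) _ _ _ oU) => // ws y _;
  [exact: sf|exact: sg].
Qed.

End smooth_on.

Record chart (R : realType) (m : nat) (T : topologicalType) := Chart {
  chart_dom : set T;
  chart_map : T -> 'rV[R]_m;
  chart_inv : 'rV[R]_m -> T;
  open_chart_dom : open chart_dom;
  open_chart_image : open (chart_map @` chart_dom);
  chart_mapK : {in chart_dom, cancel chart_map chart_inv};
  continuous_chart_map : {in chart_dom, continuous chart_map};
  continuous_chart_inv : {in chart_map @` chart_dom, continuous chart_inv} }.

(* Smooth manifolds without boundary, of dimension [m].  The atlas need not be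
   maximal; connectedness is not part of the definition. *)
Record manifold (R : realType) (m : nat) := Manifold {
  manifold_space :> topologicalType;
  atlas : set (chart R m manifold_space);
  manifold_hausdorff : hausdorff_space manifold_space;
  manifold_second_countable : @second_countable manifold_space;
  atlas_cover : forall x, exists2 c, atlas c & chart_dom c x;
  atlas_compatible : forall c d, atlas c -> atlas d -> forall i : 'I_m,
    smooth_on (chart_map c @` (chart_dom c `&` chart_dom d))
              (fun x => chart_map d (chart_inv c x) ord0 i) }.

Section smooth_functions.
Variables (R : realType) (m : nat) (M : manifold R m).
Implicit Types f g : M -> R.

Definition smooth f := forall c, atlas c ->
  smooth_on (chart_map c @` chart_dom c) (f \o chart_inv c).

Definition smooth_pred : {pred M -> R} := fun f => `[< smooth f >].

Fact smooth_cst c : cst c \in smooth_pred.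
Proof. by apply/asboolP => d _; exact: smooth_on_cst. Qed.

Fact smoothD : {in smooth_pred &, forall f g, f + g \in smooth_pred}.
Proof.
move=> f g /asboolP sf /asboolP sg; apply/asboolP => c cM.
by apply: smooth_onD; [exact: open_chart_image|exact: sf|exact: sg].
Qed.

Fact smoothM : {in smooth_pred &, forall f g, f * g \in smooth_pred}.
Proof.
move=> f g /asboolP sf /asboolP sg; apply/asboolP => c cM.
by apply: smooth_onM; [exact: open_chart_image|exact: sf|exact: sg].
Qed.

Fact smoothB : {in smooth_pred &, forall f g, f - g \in smooth_pred}.
Proof.
move=> f g sf sg; rewrite -[g]mul1r -mulNr; apply: smoothD => //.
by apply: smoothM => //; exact: (smooth_cst (- 1)).
Qed.

Fact smooth_subring : subring_closed smooth_pred.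
Proof. by split; [exact: smooth_cst|exact: smoothB|exact: smoothM]. Qed.

HB.instance Definition _ :=
  GRing.isSubringClosed.Build (M -> R) smooth_pred smooth_subring.

Fact smooth_scale (a : R) : {in smooth_pred, forall f, a *: f \in smooth_pred}.
Proof. by move=> f; exact/smoothM/smooth_cst. Qed.

HB.instance Definition _ :=
  GRing.isScaleClosed.Build R (M -> R) smooth_pred smooth_scale.

Record cinfty := Cinfty {
  cinfty_fun :> M -> R; _ : cinfty_fun \in smooth_pred }.

HB.instance Definition _ := [isSub of cinfty for cinfty_fun].
HB.instance Definition _ := [Choice of cinfty by <:].
HB.instance Definition _ := GRing.SubChoice_isSubComPzRing.Build (M -> R) _ cinfty
  (subringClosedP _).
HB.instance Definition _ := [SubZmodule_isSubLmodule of cinfty by <:].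

End smooth_functions.

(* [cinfty M] is the ring C^oo(M).  Vector fields are its R-linear derivations;
   they form a C^oo(M)-module [vfield M], and tensor fields are represented
   below as C^oo(M)-multilinear maps on this module: 1-forms are
   [{scalar vfield M}] and (1,1)-tensors [{linear vfield M -> vfield M}]. *)
Section vector_fields.
Variables (R : realType) (m : nat) (M : manifold R m).
Implicit Types f h k : cinfty M.

Record vfield := VField {
  vfield_fun :> cinfty M -> cinfty M;
  vfield_linear : linear vfield_fun;
  vfieldM : forall f h,
    vfield_fun (f * h) = f * vfield_fun h + h * vfield_fun f }.

HB.instance Definition _ (X : vfield) :=
  GRing.isLinear.Build R (cinfty M) (cinfty M) *:%R X (vfield_linear X).

HB.instance Definition _ := gen_eqMixin vfield.
HB.instance Definition _ := gen_choiceMixin vfield.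

Implicit Types X Y Z : vfield.

Lemma vfieldP X Y : X =1 Y -> X = Y.
Proof.
case: X Y => [X lX dX] [Y lY dY] /= /funext XY.
by rewrite -XY in lY dY *; congr VField; exact: Prop_irrelevance.
Qed.

Fact mul_scale (a : R) f h : f * (a *: h) = a *: (f * h).
Proof. by apply/val_inj/funext => x; exact: mulrCA. Qed.

Fact vfield_zero_linear : linear (fun _ : cinfty M => 0 : cinfty M).
Proof. by move=> a f h; rewrite scaler0 addr0. Qed.
Fact vfield_zeroM f h : 0 = f * 0 + h * 0 :> cinfty M.
Proof. by rewrite !mulr0 addr0. Qed.
Definition vfield_zero := VField vfield_zero_linear vfield_zeroM.

Fact vfield_add_linear X Y : linear (fun f => X f + Y f).
Proof. by move=> a f h; rewrite !linearP scalerDr addrACA. Qed.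
Fact vfield_addM X Y f h :
  X (f * h) + Y (f * h) = f * (X h + Y h) + h * (X f + Y f).
Proof. by rewrite !vfieldM !mulrDr addrACA. Qed.
Definition vfield_add X Y := VField (vfield_add_linear X Y) (vfield_addM X Y).

Fact vfield_opp_linear X : linear (fun f => - X f).
Proof. by move=> a f h; rewrite linearP opprD scalerN. Qed.
Fact vfield_oppM X f h : - X (f * h) = f * - X h + h * - X f.
Proof. by rewrite vfieldM !mulrN opprD. Qed.
Definition vfield_opp X := VField (vfield_opp_linear X) (vfield_oppM X).

Fact vfield_scale_linear k X : linear (fun f => k * X f).
Proof. by move=> a f h; rewrite linearP mulrDr mul_scale. Qed.
Fact vfield_scaleM k X f h : k * X (f * h) = f * (k * X h) + h * (k * X f).
Proof. by rewrite vfieldM mulrDr !(mulrCA k). Qed.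
Definition vfield_scale k X :=
  VField (vfield_scale_linear k X) (vfield_scaleM k X).

Fact vfield_addA : associative vfield_add.
Proof. by move=> X Y Z; apply: vfieldP => f; exact: addrA. Qed.
Fact vfield_addC : commutative vfield_add.
Proof. by move=> X Y; apply: vfieldP => f; exact: addrC. Qed.
Fact vfield_add0 : left_id vfield_zero vfield_add.
Proof. by move=> X; apply: vfieldP => f; exact: add0r. Qed.
Fact vfield_addN : left_inverse vfield_zero vfield_opp vfield_add.
Proof. by move=> X; apply: vfieldP => f; exact: addNr. Qed.

HB.instance Definition _ := GRing.isZmodule.Build vfield
  vfield_addA vfield_addC vfield_add0 vfield_addN.

Fact vfield_scaleA f h X :
  vfield_scale f (vfield_scale h X) = vfield_scale (f * h) X.
Proof. by apply: vfieldP => k; exact: mulrA. Qed.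
Fact vfield_scale1 : left_id 1 vfield_scale.
Proof. by move=> X; apply: vfieldP => k; exact: mul1r. Qed.
Fact vfield_scaleDr : right_distributive vfield_scale +%R.
Proof. by move=> f X Y; apply: vfieldP => k; exact: mulrDr. Qed.
Fact vfield_scaleDl X : {morph vfield_scale^~ X : f h / f + h}.
Proof. by move=> f h; apply: vfieldP => k; exact: mulrDl. Qed.

HB.instance Definition _ := GRing.Zmodule_isLmodule.Build (cinfty M) vfield
  vfield_scaleA vfield_scale1 vfield_scaleDr vfield_scaleDl.

Fact lie_bracket_linear X Y : linear (fun f => X (Y f) - Y (X f)).
Proof. by move=> a f h; rewrite !linearP addrACA scalerDr. Qed.
Fact lie_bracketM X Y f h : X (Y (f * h)) - Y (X (f * h)) =
  f * (X (Y h) - Y (X h)) + h * (X (Y f) - Y (X f)).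
Proof.
rewrite !vfieldM !linearD /= !vfieldM.
move: (X f) (X h) (Y f) (Y h) (X (Y f)) (X (Y h)) (Y (X f)) (Y (X h)).
by move=> *; ring.
Qed.
Definition lie_bracket X Y := VField (lie_bracket_linear X Y) (lie_bracketM X Y).

(* The tangent vector of X at x is zero. *)
Definition vanishes_at X (x : M) := forall f, X f x = 0.

End vector_fields.

Section forms.
Variables (R : realType) (m : nat) (M : manifold R m).
Local Notation C := (cinfty M).
Local Notation VF := (vfield M).
Implicit Types (X Y Z : VF) (eta : {scalar VF}) (w : VF -> VF -> C).

(* Exterior derivative of 1-forms and 2-forms, with the normalization
   (k+1) dw(X_0, .., X_k) = \sum_i (-1)^i X_i (w(.., ^X_i, ..)) + ... *)
Definition d1 eta X Y : C :=
  (2^-1 : R) *: (X (eta Y) - Y (eta X) - eta (lie_bracket X Y)).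

Definition d2 w X Y Z : C :=
  (3^-1 : R) *: (X (w Y Z) + Y (w Z X) + Z (w X Y)
    - w (lie_bracket X Y) Z - w (lie_bracket Y Z) X - w (lie_bracket Z X) Y).

(* The wedge product is Alt (w (x) t), where Alt averages over permutations:
   this is the convention that goes with the factor 1/(k+1) in d. *)
Definition kform k := ('I_k -> VF) -> C.

Definition wedge k l (w : kform k) (t : kform l) : kform (k + l) := fun Xs =>
  ((k + l)`!%:R^-1 : R) *: \sum_(s : 'S_(k + l)) (-1) ^+ s *
    (w (fun i => Xs (s (lshift l i))) * t (fun j => Xs (s (rshift k j)))).

Fixpoint wedge_pow k (w : kform k) p : kform (p * k) :=
  match p with
  | 0 => fun=> 1
  | q.+1 => wedge w (@wedge_pow k w q)
  end.
Arguments wedge_pow {k} w p _.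

Definition kform1 eta : kform 1 := fun Xs => eta (Xs 0).
Definition kform2 w : kform 2 := fun Xs => w (Xs 0) (Xs 1).

(* [eta] has constant rank [r] = 2p+1: the form eta /\ (d eta)^p is nonzero at
   every point of M, and (d eta)^(p+1) = 0. *)
Definition has_rank eta r := exists p, [/\ r = (2 * p + 1)%N,
  forall x : M, exists Xs,
    wedge (kform1 eta) (wedge_pow (kform2 (d1 eta)) p) Xs x <> 0 &
  forall Xs, wedge_pow (kform2 (d1 eta)) p.+1 Xs = 0].

End forms.

Section contact.
Variables (R : realType) (m : nat) (M : manifold R m).
Local Notation C := (cinfty M).
Local Notation VF := (vfield M).
Implicit Types X Y Z : VF.

Record riemannian_metric := RiemannianMetric {
  metric :> VF -> {scalar VF};
  metricC : forall X Y, metric X Y = metric Y X;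
  metric_gt0 : forall X (x : M), ~ vanishes_at X x -> 0 < metric X X x }.

Variable g : riemannian_metric.

Record almost_contact_metric := AlmostContactMetric {
  phi : {linear VF -> VF};
  xi : VF;
  eta : {scalar VF};
  phi_phi : forall X, phi (phi X) = - X + eta X *: xi;
  eta_xi : eta xi = 1;
  metric_phi : forall X Y, g (phi X) (phi Y) = g X Y - eta X * eta Y }.

Implicit Types S : almost_contact_metric.

Definition fundamental_form S X Y : C := g X (phi S Y).

Definition nijenhuis (f : {linear VF -> VF}) X Y : VF :=
  f (f (lie_bracket X Y)) + lie_bracket (f X) (f Y)
  - f (lie_bracket (f X) Y) - f (lie_bracket X (f Y)).

Definition is_normal S := forall X Y,
  nijenhuis (phi S) X Y + (d1 (eta S) X Y *+ 2) *: xi S = 0.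

Definition quasi_sasakian S :=
  is_normal S /\ forall X Y Z, d2 (fundamental_form S) X Y Z = 0.

Definition alpha_sasakian (a : R) S := [/\ a != 0, is_normal S &
  forall X Y, d1 (eta S) X Y = a *: fundamental_form S X Y].

(* The indices 1, 2, 3 are represented by 0, 1, 2 : 'I_3. *)
Definition almost_3_contact (S : 'I_3 -> almost_contact_metric) :=
  forall s : 'S_3, ~~ odd_perm s ->
  let A := S (s 0) in let B := S (s 1) in let G := S (s 2) in
  [/\ forall X, phi G X = phi A (phi B X) - eta B X *: xi A,
      forall X, phi G X = - phi B (phi A X) + eta A X *: xi B,
      xi G = phi A (xi B) /\ xi G = - phi B (xi A),
      forall X, eta G X = eta A (phi B X) &
      forall X, eta G X = - eta B (phi A X)].

Definition three_quasi_sasakian (S : 'I_3 -> almost_contact_metric) :=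
  almost_3_contact S /\ forall i, quasi_sasakian (S i).

Definition three_alpha_sasakian a (S : 'I_3 -> almost_contact_metric) :=
  almost_3_contact S /\ forall i, alpha_sasakian a (S i).

(* The three 1-forms of a 3-quasi-Sasakian manifold have the same rank, and this
   common value is the rank of the manifold. *)
Definition three_rank (S : 'I_3 -> almost_contact_metric) r :=
  forall i, has_rank (eta (S i)) r.

End contact.

(* Main.v *)
(* For a cyclic triple (a, b, c) of the indices 1, 2, 3, normality and
   [d Phi = 0] make the [xi_a] Killing fields with [L_(xi_a) phi_a = 0], and
   Cartan's formula applied to [i_(xi_a) Phi_b = eta_c] gives
   [2 d eta_c(X, Y) = g(X, T_c Y)] with [T_c = L_(xi_a) phi_b].  As
   [T_c xi_c = 0], there is one function [kappa] with
   [[xi_a, xi_b] = kappa xi_c] for every cyclic triple.  Differentiating the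
   relations between the [phi]'s along [xi_a] expresses [T_b] through [T_c] in
   two ways, and computing [L_(xi_a) T_c] both from [T_a] and from
   [L_(xi_a) eta_c = - kappa eta_b] yields [d kappa = 0] and
   [T_c (T_a - kappa phi_a) = 0].  Maximal rank makes [T_c] injective on
   [ker eta_c], hence [2 d eta_a = kappa Phi_a].  The constant [kappa] is nonzero
   since otherwise [d eta_a = 0], against the rank hypothesis.

   Vector fields being abstract derivations, maximal rank is only usable once
   the tangent vectors at a point are known to depend on [m] parameters: this,
   and the constancy of [kappa], come from Hadamard's lemma and bump functions. *)
From HB Require Import structures.
From mathcomp Require Import all_boot all_order all_algebra all_fingroup.
From mathcomp Require Import all_classical all_reals all_analysis ring.
Require Import Defs.

Set Implicit Arguments.
Unset Strict Implicit.
Unset Printing Implicit Defensive.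

Import Order.TTheory GRing.Theory Num.Theory.
Import numFieldNormedType.Exports.

Local Open Scope classical_set_scope.
Local Open Scope ring_scope.

(** * Smooth functions on open sets *)

Section smooth_closure.
Variables (R : realType) (m : nat).
Local Notation V := 'rV[R]_m.
Implicit Types (U W : set V) (f g h : V -> R) (i j : 'I_m).

Local Notation unit_vec i := (delta_mx 0 i : V).

Lemma smooth_on_derive U f v : smooth_on U f -> smooth_on U ('D_v f).
Proof. by move=> sf vs x Ux; rewrite -iter_derive_rcons; exact: sf. Qed.

Lemma smooth_on_eq U f g : open U -> {in U, f =1 g} ->
  smooth_on U f -> smooth_on U g.
Proof.
move=> oU fg sf vs x; apply: (smooth_upto_eq oU fg (n := size vs)) => //.
by move=> ws y _; exact: sf.
Qed.

Lemma smooth_on_sub U W f : U `<=` W -> smooth_on W f -> smooth_on U f.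
Proof. by move=> UW sf vs x /UW; exact: sf. Qed.

(** Reduces smoothness to finite orders, on which proofs go by induction. *)
Lemma smooth_onP U f : smooth_on U f <-> forall n, smooth_upto n U f.
Proof.
by split=> [sf n vs x _|sf vs x]; [exact: sf|exact: (sf (size vs))].
Qed.

Lemma smooth_on_prod (I : Type) (r : seq I) U (F : I -> V -> R) : open U ->
  (forall k, smooth_on U (F k)) -> smooth_on U (\prod_(k <- r) F k).
Proof.
move=> oU sF; elim/big_ind: _ => // [|f g sf sg]; first exact: smooth_on_cst.
exact: smooth_onM.
Qed.

Lemma smooth_on_differentiable U f x : smooth_on U f -> U x -> differentiable f
  x.
Proof. by move=> sf; exact: (sf [::]). Qed.

Lemma diff_coordE f x v : differentiable f x ->
  'd f x v = \sum_i v 0 i * 'D_(unit_vec i) f x.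
Proof.
move=> df; rewrite {1}[v]row_sum_delta linear_sum; apply: eq_bigr => i _.
by rewrite linearZ deriveE.
Qed.

(** The innermost derivative along [v] is the constant [v 0 i], so all further ones are derivatives
    of a constant. *)
Lemma smooth_on_coord U i : smooth_on U (fun x => x 0 i).
Proof.
move=> vs x Ux; have d1 y : differentiable (fun x : V => x 0 i) y.
  exact: differentiable_coord.
case/lastP: vs => [|vs v]; first exact: d1.
rewrite iter_derive_rcons; suff -> : 'D_v (fun x : V => x 0 i) = cst (v 0 i).
  exact: (smooth_on_cst (v 0 i)).
apply/funext => y; rewrite deriveE//.
have lc : linear (fun x : V => x 0 i) by move=> a z t; rewrite !mxE.
pose cM := GRing.isLinear.Build R V R *:%R (fun x : V => x 0 i) lc.
pose c : {linear V -> R} := HB.pack (fun x : V => x 0 i) cM.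
by rewrite (diff_lin (f := c)) //; exact: coord_continuous.
Qed.

End smooth_closure.

Section smooth_composition.
Variables (R : realType) (m : nat).
Local Notation V := 'rV[R]_m.
Variables (U W : set V) (G : V -> V).
Hypotheses (oU : open U) (oW : open W) (GUW : forall x, U x -> W (G x)).
Hypothesis sG : forall i, smooth_on U (fun x => G x 0 i).
Local Notation unit_vec i := (delta_mx 0 i : V).

Let dG x : U x -> differentiable G x.
Proof.
move=> Ux; have -> : G = \sum_i (fun y => G y 0 i *: unit_vec i).
  by apply/funext => y; rewrite fct_sumE -row_sum_delta.
apply: differentiable_sum => i; apply: differentiableZl.
exact: smooth_on_differentiable (sG i) Ux.
Qed.

Let derive_comp (f : V -> R) v x : U x -> smooth_on W f ->
  'D_v (f \o G) x =
  \sum_i 'D_v (fun x => G x 0 i) x * 'D_(unit_vec i) f (G x).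
Proof.
move=> Ux sf; have df := smooth_on_differentiable sf (GUW Ux).
have dGx := dG Ux; rewrite (deriveE (f := f \o G));
  last exact: differentiable_comp.
rewrite (diff_comp dGx df) /= diff_coordE//; apply: eq_bigr => i _.
congr (_ * _); rewrite -deriveE// derive_mx ?mxE//.
exact: diff_derivable.
Qed.

(** Induction on the order, for all [f] at once: the chain rule writes a derivative of [f \o G]
    through the functions ['D_(unit_vec i) f \o G], where the partial derivatives of [f] are smooth
    again. *)
Lemma smooth_on_comp f : smooth_on W f -> smooth_on U (f \o G).
Proof.
suff main n : forall f, smooth_on W f -> smooth_upto n U (f \o G).
  by move=> sf; apply/smooth_onP => n; exact: main.
elim: n => [|n IH] {}f sf.
  apply/smooth_upto0 => x Ux; apply: differentiable_comp; first exact: dG.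
  exact: smooth_on_differentiable sf (GUW Ux).
apply/smooth_uptoS; split=> [x Ux|v].
  apply: differentiable_comp; first exact: dG.
  exact: smooth_on_differentiable sf (GUW Ux).
pose h := \sum_i ('D_v (fun x => G x 0 i) * ('D_(unit_vec i) f \o G)).
apply: (@smooth_upto_eq _ _ _ _ h) => // [x /set_mem Ux|].
  by rewrite derive_comp// /h fct_sumE.
rewrite /h; elim/big_ind : _ => [|g1 g2 s1 s2|i _].
- by have /smooth_onP := @smooth_on_cst R m U 0; apply.
- exact: smooth_uptoD.
- apply: smooth_uptoM => //; last exact/IH/smooth_on_derive.
  by move: n {IH}; apply/smooth_onP; exact/smooth_on_derive/sG.
Qed.

End smooth_composition.

(** * Flat functions and bump functions *)

Section flat_function.
Variable R : realType.
Implicit Types (t : R) (k : nat).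

(** The classical exp(-1/t) is the case [k = 0]; the powers of [t^-1] make the span of the family
    stable under differentiation. *)
Definition flat k t : R := if 0 < t then t^-1 ^+ k * expR (- t^-1) else 0.

Lemma flat_gt0 k t : 0 < t -> 0 < flat k t.
Proof.
by move=> t0; rewrite /flat t0 mulr_gt0 ?expR_gt0// exprn_gt0// invr_gt0.
Qed.

Lemma flat_le0 k t : t <= 0 -> flat k t = 0.
Proof. by rewrite /flat leNgt => /negbTE ->. Qed.

(** The term of order [k.+2] of the exponential series at [t^-1] is bounded by [expR t^-1]. The
    quadratic decay gives the derivative at the origin. *)
Lemma flat_bound k t : `|flat k t| <= k.+2`!%:R * t ^+ 2.
Proof.
rewrite /flat; case: ifPn => [t0|_]; last by rewrite normr0 mulr_ge0// sqr_ge0.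
have u0 : 0 < t^-1 by rewrite invr_gt0.
rewrite ger0_norm; last by rewrite mulr_ge0 ?expR_ge0// exprn_ge0// ltW.
rewrite expRN ler_pdivrMr ?expR_gt0//.
have : t^-1 ^+ k.+2 <= k.+2`!%:R * expR t^-1.
  rewrite mulrC -ler_pdivrMr ?ltr0n ?fact_gt0//.
  apply: le_trans (expR_ge1Dxn k.+1 (ltW u0)); by rewrite lerDr.
rewrite -addn2 exprD -ler_pdivlMr ?exprn_gt0// -exprVn invrK.
by rewrite mulrAC.
Qed.

Lemma is_derive_flat k t :
  is_derive t 1 (flat k) (flat k.+2 t - k%:R * flat k.+1 t).
Proof.
have [t0|t0|->] := ltgtP t 0.
- rewrite !flat_le0 ?ltW// mulr0 subr0.
  apply: (near_eq_is_derive (f := cst 0)).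
  near=> y; rewrite flat_le0//; apply/ltW; near: y; exact: lt_nbhsl.
- pose e t : R := t^-1 ^+ k * expR (- t^-1).
  apply: (near_eq_is_derive (f := e)).
    near=> y; rewrite /flat ifT//; near: y; exact: lt_nbhsr.
  have dV : is_derive t 1 (fun y : R => y^-1) (- t ^- 2).
    apply: DeriveDef; first by apply: derivableV; rewrite ?gt_eqF//;
      exact: derivable_id.
    by rewrite deriveV ?gt_eqF// derive_id [LHS]mulr1.
  have dE : is_derive t 1 (expR \o (fun y : R => - y^-1))
      (expR (- t^-1) * t ^- 2).
    rewrite -[t ^- 2]opprK; apply: is_derive1_comp.
  have -> : e = (fun y : R => y^-1) ^+ k * (expR \o (fun y : R => - y^-1)).
    by apply/funext => y; rewrite !fctE.
  apply: is_derive_eq (is_deriveM (is_deriveX k dV) dE) _.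
  rewrite /flat t0 /GRing.scale /= !fctE.
  case: k {e} => [|k]; rewrite ?exprS ?expr0 /=; field; rewrite ?gt_eqF//.
- rewrite !flat_le0// mulr0 subr0.
  suff d0 : (fun h : R => h^-1 *: (flat k (h *: 1 + 0) - flat k 0)) @ 0^' -->
    (0 : R).
    by apply: DeriveDef; [apply/cvg_ex; exists 0|apply/cvg_lim].
  apply/cvgr0Pnorm_le => e e0; near=> h.
  rewrite (@flat_le0 _ 0)// subr0 addr0 [h *: 1]mulr1 normrZ normfV.
  have h0 : h != 0 by near: h; exact: nbhs_dnbhs_neq.
  rewrite ler_pdivrMl ?normr_gt0//; apply: le_trans (flat_bound _ _) _.
  rewrite -real_normK ?num_real// expr2 mulrCA ler_pM2l ?normr_gt0//.
  rewrite -ler_pdivlMl ?ltr0n ?fact_gt0//; near: h.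
  apply: dnbhs0_le; rewrite mulr_gt0// invr_gt0 ltr0n fact_gt0//.
Unshelve. all: by end_near. Qed.

End flat_function.

Section bump.
Variables (R : realType) (m : nat).
Local Notation V := 'rV[R]_m.
Implicit Types (U : set V) (f : V -> R) (p x : V) (r : R).

(** By the chain rule a derivative involves only [flat k.+1 \o f], [flat k.+2 \o f] and a derivative
    of [f]; the induction on the order therefore quantifies over [k]. *)
Lemma smooth_on_flat U k f : open U -> smooth_on U f ->
  smooth_on U (flat k \o f).
Proof.
move=> oU sf; apply/smooth_onP => n; elim: n k => [|n IH] k.
  apply/smooth_upto0 => x Ux; apply: differentiable_comp.
    exact: smooth_on_differentiable sf Ux.
  exact/derivable1_diffP/ex_derive/is_derive_flat.
have dflat t : differentiable (flat k : R -> R) t.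
  exact/derivable1_diffP/ex_derive/is_derive_flat.
apply/smooth_uptoS; split=> [x Ux|v].
  by apply: differentiable_comp => //; exact: smooth_on_differentiable sf Ux.
apply: (@smooth_upto_eq _ _ _ _
  ((flat k.+2 \o f + cst (- k%:R) * (flat k.+1 \o f)) * 'D_v f)) => //.
  move=> x /set_mem Ux; have df := smooth_on_differentiable sf Ux.
  rewrite deriveE; last exact: differentiable_comp.
  rewrite diff_comp//= -(deriveE _ df).
  rewrite -[X in 'd _ _ X]mulr1 [in RHS]linearZ /= -deriveE//.
  have [_ ->] := is_derive_flat k (f x).
  by rewrite !fctE [RHS]mulrC mulNr.
apply: smooth_uptoM => //; last by move: n {IH};
  exact/smooth_onP/smooth_on_derive.
apply: smooth_uptoD => //; apply: smooth_uptoM => //.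
by move: n {IH}; exact/smooth_onP/smooth_on_cst.
Qed.

(** Nonzero exactly on the open cube of half-side [r] around [p], which is a ball for the sup norm
    when [r] is positive. *)
Definition bump p r x : R :=
  \prod_i (flat 0 (r - (x 0 i - p 0 i)) * flat 0 (r + (x 0 i - p 0 i))).

Lemma bump_smooth p r U : open U -> smooth_on U (bump p r).
Proof.
move=> oU; have sc i : smooth_on U (fun x : V => x 0 i - p 0 i).
  have := smooth_onD oU (@smooth_on_coord _ _ U i) (@smooth_on_cst _ m U (- p 0
    i)).
  exact: smooth_on_eq.
pose F i : V -> R := (flat 0 \o (cst r + cst (-1) * (fun x : V =>
  x 0 i - p 0 i)))
  * (flat 0 \o (cst r + (fun x : V => x 0 i - p 0 i))).
apply: (@smooth_on_eq _ _ _ (\prod_i F i)) => // [x _|].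
  rewrite /bump fct_prodE; apply: eq_bigr => i _.
  by rewrite /F !fctE mulN1r.
apply: smooth_on_prod => // i; apply: smooth_onM => //;
  apply: smooth_on_flat => //;
  apply: smooth_onD => //; try exact: smooth_on_cst.
by apply: smooth_onM => //; exact: smooth_on_cst.
Qed.

Lemma bump_gt0 p r x : (forall i, `|x 0 i - p 0 i| < r) -> 0 < bump p r x.
Proof.
move=> xp; apply: prodr_gt0 => i _; have := xp i;
  rewrite ltr_norml => /andP[a b].
by apply: mulr_gt0; apply: flat_gt0; [rewrite subr_gt0|rewrite -ltrBlDl sub0r].
Qed.

Lemma bump_neq0 p r x : bump p r x != 0 -> forall i, `|x 0 i - p 0 i| < r.
Proof.
move=> /prodf_neq0 + i => /(_ i isT); rewrite mulf_eq0 => /norP[a b].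
rewrite ltr_norml; apply/andP; split.
  rewrite -subr_gt0 opprK addrC ltNge; apply: contra b => /flat_le0 ->;
    exact: eqxx.
by rewrite -subr_gt0 ltNge; apply: contra a => /flat_le0 ->.
Qed.

End bump.

(** * Extension by zero of functions supported in a chart *)

Section extension_by_zero.
Variables (R : realType) (m : nat) (M : manifold R m).
Local Notation V := 'rV[R]_m.
Variable c : chart R m M.
Hypothesis cM : atlas c.
Implicit Types (d : chart R m M) (O : set M) (f : M -> R) (h : V -> R).

Lemma open_chart_sub d O : open O -> open (chart_map d @` (chart_dom d `&` O)).
Proof.
move=> oO; rewrite openE => _ [x [dx Ox] <-].
have imx : (chart_map d @` chart_dom d) (chart_map d x) by exists x.
have nim : nbhs (chart_map d x) (chart_map d @` chart_dom d).
  by apply: open_nbhs_nbhs; split => //; exact: open_chart_image.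
have nO : nbhs (chart_map d x) (chart_inv d @^-1` O).
  apply: (continuous_chart_inv (mem_set imx)).
  by apply: open_nbhs_nbhs; rewrite (chart_mapK (mem_set dx)).
apply: filterS (filterI nim nO) => _ [[y dy <-]] /=.
by rewrite (chart_mapK (mem_set dy)) => Oy; exists y.
Qed.

Lemma smooth_locally f :
  (forall x, exists O, [/\ open O, O x & forall d, atlas d ->
    smooth_on (chart_map d @` (chart_dom d `&` O)) (f \o chart_inv d)]) ->
  smooth f.
Proof.
move=> loc d dM vs _ [x dx <-]; case: (loc x) => O [_ Ox sO].
by apply: (sO d dM); exists x.
Qed.

Definition extend h (x : M) : R :=
  if `[< chart_dom c x >] then h (chart_map c x) else 0.

(** The closed cube [K] is compact and lies in the ball of radius [2 * r], so its image in [M] is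
    compact, hence closed since [M] is Hausdorff. Around a point of that image the extension is [h]
    in coordinates; on the open complement it is zero. *)
Lemma extend_smooth (p : V) r h : 0 < r ->
  ball p (2 * r) `<=` chart_map c @` chart_dom c ->
  smooth_on (ball p (2 * r)) h ->
  (forall y, h y != 0 -> forall i, `|y 0 i - p 0 i| < r) ->
  smooth (extend h).
Proof.
move=> r0 pc sh h0.
have r20 : 0 < 2 * r by rewrite mulr_gt0.
pose K := [set y : V | forall i, y 0 i \in `[p 0 i - r, p 0 i + r]].
have Kball : K `<=` ball p (2 * r).
  move=> y Ky; split=> // i j; rewrite ord1 /ball /= distrC.
  have : `|y 0 j - p 0 j| <= r by have := Ky j; rewrite ler_distl in_itv.
  by move=> /le_lt_trans; apply; rewrite mulr_natl mulr2n ltrDl.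
have clK : closed (chart_inv c @` K).
  apply: compact_closed; first exact: manifold_hausdorff.
  apply: continuous_compact; last first.
    exact: (@rV_compact _ _ (fun i => `[p 0 i - r, p 0 i + r]%classic)
      (fun i => @segment_compact _ _ _)).
  apply: continuous_in_subspaceT => y /set_mem /Kball /pc iy.
  exact/continuous_chart_inv/mem_set.
apply: smooth_locally => x.
have [[y Ky yx]|nKx] := pselect ((chart_inv c @` K) x).
  pose O := chart_dom c `&` (chart_map c @^-1` ball p (2 * r)).
  have oO : open O.
    rewrite openE => z [cz bz]; apply: filterI.
      by apply: open_nbhs_nbhs; split => //; exact: open_chart_dom.
    apply: (continuous_chart_map (mem_set cz)).
    by apply: open_nbhs_nbhs; split => //; exact: ball_open.
  exists O; split => // [|d dM].
    have [z cz zy] := pc _ (Kball _ Ky); rewrite -yx -zy.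
    rewrite /O /= (chart_mapK (mem_set cz)); split => //.
    by rewrite /= zy; exact: Kball.
  have dO z : chart_dom d z -> chart_inv d (chart_map d z) = z.
    by move=> dz; rewrite (chart_mapK (mem_set dz)).
  apply: (@smooth_on_eq _ _ _ (h \o (chart_map c \o chart_inv d))) =>
    [|_ /set_mem[z [dz [cz _]] <-]|].
  - exact: open_chart_sub.
  - by rewrite /= dO// /extend asboolT.
  apply: (@smooth_on_comp _ _ _ (ball p (2 * r))) => //.
  - exact: open_chart_sub.
  - by move=> _ [z [dz [cz bz]] <-] /=; rewrite dO.
  - move=> i; apply: smooth_on_sub (atlas_compatible dM cM i).
    by move=> _ [z [dz [cz bz]] <-]; exists z.
exists (~` (chart_inv c @` K)); split => // [|d dM]; first exact: closed_openC.
apply: (@smooth_on_eq _ _ _ (cst 0)) => [|_ /set_mem[z [dz nz] <-]|];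
  last exact: smooth_on_cst.
  by apply: open_chart_sub; exact: closed_openC.
rewrite /= (chart_mapK (mem_set dz)) /extend; case: asboolP => // cz.
apply/esym/eqP; apply: contraT => /h0 b; case: nz; exists (chart_map c z).
  by move=> i; rewrite in_itv /= -ler_distl ltW.
by rewrite (chart_mapK (mem_set cz)).
Qed.

End extension_by_zero.

(** * Hadamard's lemma *)

Lemma differentiable_eqaddo (R : realType) (V W : normedModType R)
    (f : V -> W) x (L : {linear V -> W}) : continuous L ->
  (forall e : R, 0 < e ->
     \forall v \near 0, `|f (v + x) - f x - L v| <= e * `|v|) ->
  differentiable f x /\ 'd f x = L :> (V -> W).
Proof.
move=> contL expn; have eg : f \o shift x = cst (f x) + L +o_ 0 id.
  apply/eqaddoP => e e0; apply: filterS (expn e e0) => v.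
  by rewrite !fctE opprD addrA.
have dL := diff_unique contL eg.
by split=> //; apply/diff_locallyP; rewrite dL.
Qed.

Section strict_differentiability.
Variables (R : realType) (m : nat).
Local Notation V := 'rV[R]_m.
Local Notation unit_vec i := (delta_mx 0 i : V).
Implicit Types (U : set V) (f : V -> R) (x y z v : V).

Lemma is_derive_line f z v (t : R) : differentiable f (z + t *: v) ->
  is_derive t 1 (fun s : R => f (z + s *: v)) ('d f (z + t *: v) v).
Proof.
move=> df; pose l : R -> V := cst z + ( *:%R ^~ v).
have dl : differentiable l t by apply: differentiableD.
have dfl : differentiable f (l t) by [].
apply: DeriveDef; first exact/derivable1_diffP/(differentiable_comp dl dfl).
rewrite (deriveE (f := f \o l)); last exact: differentiable_comp.
rewrite (diff_comp dl dfl) /=; congr ('d f _ _).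
have dE : is_diff t l (0 + ( *:%R ^~ v)) by exact: is_diffD.
by rewrite (diff_val (df := 0 + ( *:%R ^~ v))) fctE add0r scale1r.
Qed.

Lemma coord_le_norm v i : `|v 0 i| <= `|v|.
Proof.
by rewrite [leRHS]/Num.Def.normr /= mx_normrE; apply/bigmax_geP; right;
  exists (0, i).
Qed.

(* Uniformity of the first order expansion in the base point, by the mean value
   theorem and continuity of the partial derivatives. *)
Lemma strictly_differentiable U f z0 (e : R) : open U ->
  smooth_on U f -> U z0 -> 0 < e -> \forall z \near z0 & v \near (0 : V),
    `|f (z + v) - f z - \sum_i v 0 i * 'D_(unit_vec i) f z| <= e * `|v|.
Proof.
(* Each of the [m] partial derivatives varies by at most [2 * e'] between two points near [z0];
   [m.+1] keeps the denominator nonzero when [m = 0]. *)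
move=> oU sf Uz0 e0; pose e' := e / (2 * m.+1%:R).
have e'0 : 0 < e' by rewrite divr_gt0// mulr_gt0.
pose N := [set z | U z /\ forall i,
  `|'D_(unit_vec i) f z0 - 'D_(unit_vec i) f z| < e'].
have cN i : \forall z \near z0,
  `|'D_(unit_vec i) f z0 - 'D_(unit_vec i) f z| < e'.
  suff /cvgrPdist_lt/(_ _ e'0) : {for z0, continuous ('D_(unit_vec i) f)} by [].
  by apply: differentiable_continuous;
    exact: smooth_on_differentiable (smooth_on_derive _ sf) Uz0.
have : nbhs z0 N.
  by apply: filterI; [exact: open_nbhs_nbhs|exact: (@filter_forall _ _ (fun i => [set z |
    `|'D_(unit_vec i) f z0 - 'D_(unit_vec i) f z| < e']) (nbhs z0) _ cN)].
move=> /nbhs_ballP[d /= d0 dN].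
have d20 : 0 < d / 2 by rewrite divr_gt0.
exists (ball z0 (d / 2), ball 0 (d / 2)).
  by split; apply: nbhsx_ballx.
move=> [z v] [] /=; rewrite -!ball_normE /= sub0r normrN => zz0 vd.
have Nz s : s \in `[0, 1] -> N (z + s *: v).
  rewrite in_itv /= => /andP[s0 s1]; apply: dN; rewrite -ball_normE /=.
  rewrite opprD addrA (le_lt_trans (ler_normB _ _))// (splitr d) ltrD//.
  by rewrite normrZ ger0_norm// (le_lt_trans _ vd)// ler_piMl.
have [s s01] : exists2 s, s \in `[0, 1] &
    f (z + 1 *: v) - f (z + 0 *: v) = 'd f (z + s *: v) v * (1 - 0).
  apply: (@MVT_segment _ (fun s => f (z + s *: v))) => // [s s01|].
    by apply: is_derive_line; apply: smooth_on_differentiable sf _;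
      case: (Nz s (subset_itv_oo_cc s01)).
  apply: continuous_in_subspaceT => s /set_mem s01.
  apply: differentiable_continuous;
    apply/derivable1_diffP/ex_derive/is_derive_line.
  by apply: smooth_on_differentiable sf _; case: (Nz s s01).
rewrite scale1r scale0r addr0 subr0 mulr1.
have [Us Ds] := Nz s s01; have ds := smooth_on_differentiable sf Us.
move=> fE; rewrite (etrans fE (diff_coordE v ds)).
have [Uz Dz] : N z by have := Nz 0; rewrite scale0r addr0; apply;
  rewrite in_itv /= lexx ler01.
rewrite -sumrB; apply: le_trans (ler_norm_sum _ _ _) _.
apply: (@le_trans _ _ (\sum_(i < m) `|v| * (e' + e'))).
  apply: ler_sum => i _; rewrite -mulrBr normrM ler_pM ?coord_le_norm//.
  rewrite -(subrKA ('D_(unit_vec i) f z0)); apply: le_trans (ler_normD _ _) _.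
  by rewrite lerD// ltW// distrC.
rewrite sumr_const card_ord -mulrnAr [leRHS]mulrC ler_wpM2l//.
rewrite -mulr2n -mulrnA -mulr_natr /e' mulrAC ler_pdivrMr ?mulr_gt0//.
by rewrite ler_wpM2l ?(ltW e0)// natrM ler_pM2l// ler_nat.
Qed.

Lemma differentiable_expansion f x (a : 'I_m -> R) :
  (forall e : R, 0 < e -> \forall v \near (0 : V),
     `|f (v + x) - f x - \sum_i v 0 i * a i| <= e * `|v|) ->
  differentiable f x /\ forall v, 'D_v f x = \sum_i v 0 i * a i.
Proof.
move=> expn; pose L0 v := \sum_i v 0 i * a i.
have linL : linear L0.
  move=> c u v; rewrite /L0 [in RHS]/GRing.scale /= mulr_sumr -big_split /=.
  by apply: eq_bigr => i _; rewrite !mxE mulrDl mulrA.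
pose L : {linear V -> R} :=
  HB.pack L0 (GRing.isLinear.Build R V R *:%R L0 linL).
have contL : continuous L.
  move=> v; apply: differentiable_continuous.
  have -> : (L : V -> R) = \sum_i (fun v : V => v 0 i) * cst (a i).
    by apply/funext => u; rewrite fct_sumE.
  apply: differentiable_sum => i; apply: differentiableM => //.
  exact: differentiable_coord.
have [df dL] := differentiable_eqaddo contL expn.
by split=> // v; rewrite deriveE// dL.
Qed.

End strict_differentiability.

(** * Integrals over the unit interval *)

Section unit_interval_integral.
Variable R : realType.
Implicit Types (f h : R -> R) (a e : R).

Definition integral01 f : R := \int[lebesgue_measure]_(t in `[0, 1]) f t.
Definition continuous01 f := {within `[(0 : R), 1], continuous f}.

Let integrable01 f : continuous01 f ->
  lebesgue_measure.-integrable `[(0 : R), 1] (EFin \o f).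
Proof. by apply: continuous_compact_integrable; exact: segment_compact. Qed.

Lemma eq_integral01 f h : (forall t, t \in `[0, 1] -> f t = h t) ->
  integral01 f = integral01 h.
Proof. by move=> fh; apply: eq_Rintegral => t /set_mem; exact: fh. Qed.

Lemma integral01D f h : continuous01 f -> continuous01 h ->
  integral01 (fun t => f t + h t) = integral01 f + integral01 h.
Proof.
by move=> cf ch; apply: RintegralD => //;
  [exact: integrable01 cf|exact: integrable01 ch].
Qed.

Lemma integral01Z a f : continuous01 f ->
  integral01 (fun t => a * f t) = a * integral01 f.
Proof. by move=> cf; apply: RintegralZl => //; exact: integrable01. Qed.

Lemma integral01_cst a : integral01 (fun=> a) = a.
Proof.
rewrite /integral01 Rintegral_cst//= lebesgue_measure_itv/= lte_fin
  ltr01.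
by rewrite -EFinB subr0 mulr1.
Qed.

Lemma continuous01D f h : continuous01 f -> continuous01 h ->
  continuous01 (fun t => f t + h t).
Proof. by move=> cf ch t; apply: continuousD; [exact: cf|exact: ch]. Qed.

Lemma continuous01Z a f : continuous01 f -> continuous01 (fun t => a * f t).
Proof. by move=> cf t; apply: continuousM;
  [exact: cst_continuous|exact: cf]. Qed.

Lemma integral01_le f e : continuous01 f ->
  (forall t, t \in `[0, 1] -> `|f t| <= e) -> `|integral01 f| <= e.
Proof.
move=> cf fe; apply: le_trans (le_normr_Rintegral _ (integrable01 cf)) _ => //.
rewrite -[leRHS](integral01_cst e); apply: le_Rintegral => //.
- apply: integrable01 => t; apply: continuous_comp; first exact: cf.
  exact: norm_continuous.
- by apply: integrable01 => t; exact: cst_continuous.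
Qed.

Lemma integral01_sum (I : Type) (r : seq I) (F : I -> R -> R) :
  (forall i, continuous01 (F i)) ->
  continuous01 (fun t => \sum_(i <- r) F i t) /\
  integral01 (fun t => \sum_(i <- r) F i t) = \sum_(i <- r) integral01 (F i).
Proof.
move=> cF; elim: r => [|i r [cr IH]].
  split; last first.
    by rewrite -[LHS](eq_integral01 (f :=
      fun=> 0)) ?big_nil ?integral01_cst// => t _; rewrite big_nil.
  by under eq_fun do rewrite big_nil; move=> t; exact: cst_continuous.
split; first by under eq_fun do rewrite big_cons; exact: continuous01D.
rewrite big_cons -IH -integral01D//.
by apply: eq_integral01 => t _; rewrite big_cons.
Qed.

End unit_interval_integral.

Section hadamard.
Variables (R : realType) (m : nat).
Local Notation V := 'rV[R]_m.
Local Notation unit_vec i := (delta_mx 0 i : V).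
Variables (q : V) (r : R).
Local Notation B := (ball q r).
Implicit Types (f : V -> R) (p y v : V) (t : R).

Definition segment p y t : V := p + t *: (y - p).

Lemma segment_ball p y t : B p -> B y -> t \in `[0, 1] -> B (segment p y t).
Proof.
rewrite -!ball_normE /= => Bp By; rewrite in_itv /= => /andP[t0 t1].
have -> : q - segment p y t = (1 - t) *: (q - p) + t *: (q - y).
  by apply/rowP => i; rewrite !mxE; ring.
apply: le_lt_trans (ler_normD _ _) _; rewrite !normrZ.
rewrite ger0_norm ?subr_ge0// (ger0_norm t0).
have [->|t_neq0] := eqVneq t 0; first by rewrite subr0 mul1r mul0r addr0.
have -> : r = (1 - t) * r + t * r by ring.
apply: ler_ltD.
  by rewrite ler_wpM2l ?subr_ge0// ltW.
by rewrite ltr_pM2l// lt_neqAle eq_sym t_neq0.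
Qed.

Lemma segment_differentiable p y t : differentiable (segment p y) t.
Proof.
have -> : segment p y = cst p + ( *:%R ^~ (y - p)) by [].
exact: differentiableD.
Qed.

(** With [k = 0] and a partial derivative for [f], this is a coefficient of Hadamard's formula.
    Differentiation in [y] brings out one factor [t], hence the weight [t ^+ k]. *)
Definition segment_mean k f p y : R :=
  integral01 (fun t => t ^+ k * f (segment p y t)).

Lemma segment_continuous k f p y : smooth_on B f -> B p -> B y ->
  continuous01 (fun t => t ^+ k * f (segment p y t)).
Proof.
move=> sf Bp By; apply: continuous_in_subspaceT => t /set_mem t01.
apply: (@cvgM R R (nbhs t) _ (fun t => t ^+ k) (fun t => f (segment p y t))).
  exact: exprn_continuous.
apply: continuous_comp;
  first exact/differentiable_continuous/segment_differentiable.
apply/differentiable_continuous/(smooth_on_differentiable sf).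
exact: segment_ball.
Qed.

(** Differentiation under the integral sign: the first order error of the mean is the mean of the
    first order errors of [f] along the segment. *)
Lemma segment_mean_expansion k f p y (e : R) : smooth_on B f -> B p -> B y ->
  0 < e -> \forall v \near (0 : V),
  `|segment_mean k f p (v + y) - segment_mean k f p y -
    \sum_i v 0 i * segment_mean k.+1 ('D_(unit_vec i) f) p y| <= e * `|v|.
Proof.
move=> sf Bp By e0.
pose P v t := `|f (segment p y t + t *: v) - f (segment p y t) -
  \sum_i (t *: v) 0 i * 'D_(unit_vec i) f (segment p y t)| <= e * `|t *: v|.
(* Strict differentiability bounds the error near each point of the segment; compactness of [[0, 1]]
   makes the condition on [v] uniform in [t]. *)
have unif : \forall v \near (0 : V), `[0, 1]%classic `<=` P v.
  have /compact_near_coveringP cov := @segment_compact R 0 1.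
  apply: (cov _ (nbhs (0 : V)) P) => t0 t01.
  have Bt0 : B (segment p y t0) by exact: segment_ball.
  have [[A D] /= [nA nD] AD] :=
    strictly_differentiable (@ball_open _ _ q r) sf Bt0 e0.
  have nA' : \forall t \near t0, A (segment p y t).
    exact: (differentiable_continuous (segment_differentiable p y t0)).
  have nD' : \forall t \near t0 & v \near (0 : V), D (t *: v).
    by have := @scale_continuous _ V (t0, 0); apply; rewrite /= scaler0.
  case: nD' => -[T W] /= [nT nW] TW.
  exists (T `&` [set t | A (segment p y t)], W) => /=.
    by split => //; exact: filterI.
  by move=> [t v] [/= [Tt At] Wv]; apply: (AD (segment p y t, t *: v));
    split => //; exact: (TW (t, v)).
have nB : \forall v \near (0 : V), B (v + y).
  suff : \forall z \near y, B z by rewrite (near_shift 0) subr0.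
  by apply: open_nbhs_nbhs; split => //; exact: ball_open.
apply: filterS2 unif nB => v Pv Bvy.
have segD t : segment p (v + y) t = segment p y t + t *: v.
  by apply/rowP => i; rewrite !mxE; ring.
have sfi i : smooth_on B ('D_(unit_vec i) f) by exact: smooth_on_derive.
pose G i t := - v 0 i * (t ^+ k.+1 * 'D_(unit_vec i) f (segment p y t)).
have cG i : continuous01 (G i).
  exact/continuous01Z/(segment_continuous (k := k.+1) (sfi i) Bp By).
have [cs is_] := integral01_sum (index_enum 'I_m) cG.
have cvy := segment_continuous (k := k) sf Bp Bvy.
have cy := continuous01Z (a := -1) (segment_continuous (k := k) sf Bp By).
have -> : segment_mean k f p (v + y) - segment_mean k f p y -
    \sum_i v 0 i * segment_mean k.+1 ('D_(unit_vec i) f) p y =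
  integral01 (fun t => t ^+ k * f (segment p (v + y) t) +
    (-1) * (t ^+ k * f (segment p y t)) +
    \sum_i - v 0 i * (t ^+ k.+1 * 'D_(unit_vec i) f (segment p y t))).
  rewrite !integral01D//; last exact: continuous01D.
  rewrite is_ integral01Z ?mulN1r; last exact: segment_continuous sf Bp By.
  congr (_ - _ + _); rewrite -sumrN; apply: eq_bigr => i _.
  by rewrite integral01Z ?mulNr//; exact: segment_continuous (sfi i) Bp By.
apply: integral01_le; first exact/continuous01D/cs/continuous01D.
move=> t t01; have := Pv t t01; rewrite /P -segD normrZ => le_e.
have /andP[t0 t1] : 0 <= t <= 1 by move: t01; rewrite in_itv.
have -> : t ^+ k * f (segment p (v + y) t) + (-1) * (t ^+ k * f (segment p y
  t)) +
    \sum_i - v 0 i * (t ^+ k.+1 * 'D_(unit_vec i) f (segment p y t)) =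
  t ^+ k * (f (segment p (v + y) t) - f (segment p y t) -
    \sum_i (t *: v) 0 i * 'D_(unit_vec i) f (segment p y t)).
  rewrite !mulrBr mulN1r; congr (_ + _); rewrite mulr_sumr -sumrN.
  by apply: eq_bigr => i _; rewrite mxE exprS; ring.
rewrite normrM normrX (ger0_norm t0).
apply: le_trans (_ : 1 * (e * `|v|) <= _); last by rewrite mul1r.
apply: ler_pM => //; [by rewrite exprn_ge0|by rewrite exprn_ile1|].
by apply: le_trans le_e _; rewrite ler_wpM2l ?(ltW e0)// ler_piMl// ger0_norm.
Qed.

(** A derivative of a mean is a combination of means of partial derivatives with weight [k.+1], so
    the induction on the order quantifies over [k] and [f]. *)
Lemma segment_mean_smooth k f p : smooth_on B f -> B p ->
  smooth_on B (segment_mean k f p).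
Proof.
move=> + Bp; suff main n : forall k f, smooth_on B f ->
    smooth_upto n B (segment_mean k f p).
  by move=> sf; apply/smooth_onP => n; exact: main.
elim: n => [|n IH] {}k {}f sf.
  apply/smooth_upto0 => y By.
  by have [] := differentiable_expansion (fun e =>
    segment_mean_expansion k sf Bp By (e := e)).
have D y (By : B y) := differentiable_expansion
  (fun e => segment_mean_expansion k sf Bp By (e := e)).
apply/smooth_uptoS; split=> [y By|v]; first by have [] := D y By.
apply: (@smooth_upto_eq _ _ _ _
  (\sum_i cst (v 0 i) * segment_mean k.+1 ('D_(unit_vec i) f) p)).
- exact: ball_open.
- by move=> y /set_mem By; have [_ ->] := D y By; rewrite fct_sumE.
elim/big_ind : _ => [|g1 g2 s1 s2|i _].
- by have /smooth_onP := @smooth_on_cst R m B 0; apply.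
- by apply: smooth_uptoD => //; exact: ball_open.
- apply: smooth_uptoM; first exact: ball_open.
    by move: n {IH}; exact/smooth_onP/smooth_on_cst.
  exact/IH/smooth_on_derive.
Qed.

(** Identifies Hadamard's coefficients at the base point with the partial derivatives there. *)
Lemma segment_mean_base f p : segment_mean 0 f p p = f p.
Proof.
rewrite -[RHS]integral01_cst; apply: eq_integral01 => t _.
by rewrite expr0 mul1r /segment subrr scaler0 addr0.
Qed.

(** The fundamental theorem of calculus for [f] along the segment from [p] to [y]. *)
Lemma hadamard f p y : smooth_on B f -> B p -> B y ->
  f y - f p = \sum_i (y 0 i - p 0 i) * segment_mean 0 ('D_(unit_vec i) f) p y.
Proof.
move=> sf Bp By; pose F t := f (segment p y t).
pose dF t := \sum_i (y 0 i - p 0 i) * (t ^+ 0 * 'D_(unit_vec i) f (segment p y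
  t)).
have sfi i : smooth_on B ('D_(unit_vec i) f) by exact: smooth_on_derive.
pose G i t := (y 0 i - p 0 i) * (t ^+ 0 * 'D_(unit_vec i) f (segment p y t)).
have cG i : continuous01 (G i).
  exact/continuous01Z/(segment_continuous (k := 0) (sfi i) Bp By).
have [cdF idF] := integral01_sum (index_enum 'I_m) cG.
have dFE t : t \in `[0, 1] -> is_derive t 1 F (dF t).
  move=> t01; have df : differentiable f (p + t *: (y - p)).
    exact: smooth_on_differentiable sf (segment_ball Bp By t01).
  apply: is_derive_eq (is_derive_line df) _.
  rewrite diff_coordE//; apply: eq_bigr => i _.
  by rewrite !mxE expr0 mul1r.
have cF t : t \in `[0, 1] -> {for t, continuous F}.
  by move=> t01; apply/differentiable_continuous/derivable1_diffP;
    have [] := dFE t t01.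
have dcF : derivable_oo_LRcontinuous F 0 1.
  split; first by move=> t t01; have [] := dFE t (subset_itv_oo_cc t01).
  - by apply/cvg_at_right_filter/cF; rewrite in_itv /= lexx ler01.
  - by apply/cvg_at_left_filter/cF; rewrite in_itv /= lexx ler01.
have F1E : {in `]0, 1[, derive1 F =1 dF}.
  by move=> t t01; rewrite derive1E;
    have [_ ->] := dFE t (subset_itv_oo_cc t01).
have FTC := continuous_FTC2 ltr01 cdF dcF F1E.
have intF : integral01 dF = F 1 - F 0 by rewrite /integral01 /Rintegral FTC.
have -> : f y = F 1 by rewrite /F /segment scale1r addrC subrK.
have -> : f p = F 0 by rewrite /F /segment scale0r addr0.
rewrite -intF [LHS]idF; apply: eq_bigr => i _.
exact/integral01Z/(segment_continuous (k := 0) (sfi i) Bp By).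
Qed.

End hadamard.

(** * Derivations and 1-forms *)

Section vector_field_calculus.
Variables (R : realType) (m : nat) (M : manifold R m).
Local Notation C := (cinfty M).
Local Notation VF := (vfield M).
Implicit Types (f h k : C) (X Y Z : VF) (w : {scalar VF}) (x : M).
Local Notation "[: X , Y :]" := (lie_bracket X Y) (at level 0).

Lemma cinftyP f h : f =1 h -> f = h.
Proof. by move=> fh; apply/val_inj/funext. Qed.

Lemma cinftyZE (a : R) f x : (a *: f) x = a * f x. Proof. by []. Qed.
Lemma cinftyME f h x : (f * h) x = f x * h x. Proof. by []. Qed.
Lemma cinftyDE f h x : (f + h) x = f x + h x. Proof. by []. Qed.
Lemma cinfty1E x : (1 : C) x = 1. Proof. by []. Qed.
Lemma cinftyNE f x : (- f) x = - f x. Proof. by []. Qed.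

(** Stands in for cancellation, as C^oo(M) may have zero divisors. *)
Lemma cinfty_reduced f : f * f = 0 -> f = 0.
Proof.
move=> ff; apply: cinftyP => x; have /eqP : (f * f) x = 0 by rewrite ff.
by rewrite mulf_eq0 orbb => /eqP.
Qed.

Lemma vfield1 X : X 1 = 0.
Proof.
by have /eqP := vfieldM X 1 1; rewrite !mul1r -subr_eq subrr => /eqP.
Qed.

Lemma vfieldB X f h : X (f - h) = X f - X h. Proof. exact: linearB. Qed.
Lemma vfieldD X f h : X (f + h) = X f + X h. Proof. exact: linearD. Qed.
Lemma vfieldN X f : X (- f) = - X f. Proof. exact: linearN. Qed.
Lemma vfieldZ X (a : R) f : X (a *: f) = a *: X f. Proof. exact: linearZ. Qed.
Lemma vfield_sum X (I : Type) (s : seq I) (F : I -> C) :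
  X (\sum_(i <- s) F i) = \sum_(i <- s) X (F i).
Proof. exact: linear_sum. Qed.
Lemma vfield0 X : X 0 = 0. Proof. exact: linear0. Qed.

Lemma vfieldDE X Y f : (X + Y) f = X f + Y f. Proof. by []. Qed.
Lemma vfield0E f : (0 : VF) f = 0. Proof. by []. Qed.
Lemma vfieldNE X f : (- X) f = - X f. Proof. by []. Qed.
Lemma vfieldZE h X f : (h *: X) f = h * X f. Proof. by []. Qed.

Lemma scalar_formZ w f X : w (f *: X) = f * w X.
Proof. exact: linearZ. Qed.

Lemma scalar_formB w X Y : w (X - Y) = w X - w Y. Proof. exact: linearB. Qed.
Lemma scalar_formD w X Y : w (X + Y) = w X + w Y. Proof. exact: linearD. Qed.
Lemma scalar_formN w X : w (- X) = - w X. Proof. exact: linearN. Qed.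
Lemma scalar_form0 w : w 0 = 0. Proof. exact: linear0. Qed.

Lemma bracketE X Y f : [: X, Y :] f = X (Y f) - Y (X f). Proof. by []. Qed.

Lemma bracketC X Y : [: X, Y :] = - [: Y, X :].
Proof. by apply: vfieldP => f; rewrite vfieldNE !bracketE opprB. Qed.

Lemma bracketXX X : [: X, X :] = 0.
Proof. by apply: vfieldP => f; rewrite /= subrr. Qed.

Lemma bracketDr X Y Z : [: X, Y + Z :] = [: X, Y :] + [: X, Z :].
Proof.
by apply: vfieldP => f; rewrite !(vfieldDE, bracketE) vfieldD; ring.
Qed.

Lemma bracketNr X Y : [: X, - Y :] = - [: X, Y :].
Proof. by apply: vfieldP => f; rewrite !(vfieldNE, bracketE) vfieldN; ring. Qed.

Lemma bracketZr X f Y : [: X, f *: Y :] = X f *: Y + f *: [: X, Y :].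
Proof.
by apply: vfieldP => h; rewrite !(vfieldDE, vfieldZE, bracketE) vfieldM; ring.
Qed.

Lemma bracket0r X : [: X, 0 :] = 0.
Proof. by have := bracketZr X 0 0; rewrite !scale0r scaler0 add0r. Qed.

Lemma jacobi X Y Z :
  [: X, [: Y, Z :] :] = [: [: X, Y :], Z :] + [: Y, [: X, Z :] :].
Proof. by apply: vfieldP => f; rewrite !(vfieldDE, bracketE) !vfieldB;
  ring. Qed.

(** The exterior derivative without the factor [2^-1] of [d1]. *)
Definition dd w X Y : C := X (w Y) - Y (w X) - w [: X, Y :].

Lemma d1E w X Y : d1 w X Y = (2^-1 : R) *: dd w X Y.
Proof. by []. Qed.

Lemma ddC w X Y : dd w X Y = - dd w Y X.
Proof. by rewrite /dd bracketC scalar_formN; ring. Qed.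

Lemma ddBr w X Y Z : dd w X (Y - Z) = dd w X Y - dd w X Z.
Proof.
rewrite /dd bracketDr bracketNr !scalar_formB vfieldB vfieldDE vfieldNE.
ring.
Qed.

Lemma ddZr w X f Y : dd w X (f *: Y) = f * dd w X Y.
Proof.
rewrite /dd bracketZr scalar_formD !scalar_formZ vfieldM vfieldZE.
by move: (w Y) => h; ring.
Qed.

(* [d] commutes with the Lie derivative along [Z]; [v] stands for [L_Z w]. *)
Lemma dd_lie w (v : VF -> C) Z :
  (forall X, v X = Z (w X) - w [: Z, X :]) -> forall X Y,
  Z (dd w X Y) - dd w [: Z, X :] Y - dd w X [: Z, Y :] =
  X (v Y) - Y (v X) - v [: X, Y :].
Proof.
move=> vE X Y; rewrite /dd !vE (jacobi Z X Y) !(vfieldB, scalar_formD,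
  bracketE); ring.
Qed.

Variable g : riemannian_metric M.

Lemma metricNl X Z : g (- X) Z = - g X Z.
Proof. by rewrite metricC linearN (metricC g Z). Qed.
Lemma metricZr f X Z : g X (f *: Z) = f * g X Z.
Proof. exact: scalar_formZ. Qed.
(** Wherever [X - Y] does not vanish, its square norm would be both positive and zero. *)
Lemma metric_nondegenerate X Y : (forall Z, g Z X = g Z Y) -> X = Y.
Proof.
move=> gXY; apply/eqP; rewrite -subr_eq0; apply/eqP.
apply: vfieldP => f; apply: cinftyP => x.
have [/(_ f)//|/(metric_gt0 g)] := pselect (vanishes_at (X - Y) x).
by rewrite scalar_formB gXY subrr ltxx.
Qed.

End vector_field_calculus.

(** * Quasi-Sasakian structures *)

Section contact_structure.
Variables (R : realType) (m : nat) (M : manifold R m) (g : riemannian_metric M).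
Variable S : almost_contact_metric g.
Local Notation C := (cinfty M).
Local Notation VF := (vfield M).
Implicit Types (f h k : C) (X Y Z : VF) (x : M).
Local Notation "[: X , Y :]" := (lie_bracket X Y) (at level 0).
Local Notation φ := (phi S).
Local Notation ξ := (xi S).
Local Notation η := (eta S).

Lemma phiB X Y : φ (X - Y) = φ X - φ Y. Proof. exact: linearB. Qed.
Lemma phiD X Y : φ (X + Y) = φ X + φ Y. Proof. exact: linearD. Qed.
Lemma phiN X : φ (- X) = - φ X. Proof. exact: linearN. Qed.
Lemma phiZ f X : φ (f *: X) = f *: φ X. Proof. exact: linearZ. Qed.

(** Since [φ (φ ξ) = 0], the field [φ ξ] is [k *: ξ] with [k = η (φ ξ)]. Applying [φ], then [η],
    gives [k * k = 0]. *)
Lemma phi_xi : φ ξ = 0.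
Proof.
have pp : φ (φ ξ) = 0 by rewrite phi_phi eta_xi scale1r addNr.
have pk : φ ξ = (η (φ ξ) : C) *: ξ.
  have := phi_phi S (φ ξ); rewrite pp linear0 => /esym/eqP.
  by rewrite addrC subr_eq0 => /eqP ->.
have : φ (φ ξ) = (η (φ ξ) : C) *: φ ξ by rewrite {1}pk phiZ.
rewrite pp => /(congr1 η); rewrite scalar_form0 scalar_formZ => /esym k0.
by rewrite pk (cinfty_reduced k0) scale0r.
Qed.

Lemma eta_phi X : η (φ X) = 0.
Proof.
have := phi_phi S (φ X); rewrite (phi_phi S X) phiD phiN phiZ phi_xi scaler0.
rewrite addr0 => /eqP; rewrite -subr_eq0 opprD addNKr oppr_eq0.
by move=> /eqP /(congr1 η); rewrite scalar_formZ eta_xi mulr1 scalar_form0.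
Qed.

Lemma metric_xi X : g X ξ = η X.
Proof.
have := metric_phi S X ξ; rewrite phi_xi scalar_form0 eta_xi mulr1.
by move/esym/eqP; rewrite subr_eq0 => /eqP.
Qed.

Lemma metric_phil X Y : g (φ X) Y = - g X (φ Y).
Proof.
have := metric_phi S X (φ Y).
rewrite phi_phi eta_phi mulr0 subr0 scalar_formD scalar_formN metricZr.
by rewrite metric_xi eta_phi mulr0 addr0 => <-; rewrite opprK.
Qed.

(** The Lie derivative of [φ] along [Z], evaluated at [X]. *)
Definition lie_phi Z X := [: Z, φ X :] - φ [: Z, X :].

Hypothesis normalS : is_normal S.

Lemma normal_dd X Y : nijenhuis φ X Y + dd η X Y *: ξ = 0.
Proof.
rewrite -[RHS](normalS X Y) d1E; congr (_ + _ *: _).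
by rewrite -scaler_nat scalerA mulfV ?pnatr_eq0// scale1r.
Qed.

(** At [(X, ξ)] the Nijenhuis torsion is a value of [φ], which [η] kills. *)
Lemma dd_xir X : dd η X ξ = 0.
Proof.
have /(congr1 η) := normal_dd X ξ.
rewrite /nijenhuis phi_xi !bracket0r linear0 addr0 subr0 scalar_formD.
by rewrite scalar_formB !eta_phi scalar_formZ eta_xi mulr1 subrr add0r
  scalar_form0.
Qed.

Lemma dd_xil X : dd η ξ X = 0.
Proof. by rewrite ddC dd_xir oppr0. Qed.

Lemma xi_eta X : ξ (η X) = η [: ξ, X :].
Proof.
by have /eqP := dd_xil X; rewrite /dd eta_xi vfield1 subr0 subr_eq0 => /eqP.
Qed.

(** Normality at [(X, ξ)] says that [φ] kills the difference [φ [: X, ξ :] - [: φ X, ξ :]]. So does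
    [η], and a field killed by both is zero. *)
Lemma bracket_xi_phi X : [: ξ, φ X :] = φ [: ξ, X :].
Proof.
have := normal_dd X ξ; rewrite /nijenhuis phi_xi !bracket0r linear0 addr0 subr0.
rewrite dd_xir scale0r addr0 -phiB => p0.
have := phi_phi S (φ [: X, ξ :] - [: φ X, ξ :]).
rewrite p0 linear0 scalar_formB eta_phi sub0r.
rewrite (bracketC (φ X)) scalar_formN !opprK -xi_eta eta_phi vfield0 scale0r.
rewrite addr0 (bracketC X) phiN => /esym/eqP.
by rewrite oppr_eq0 addrC subr_eq0 => /eqP.
Qed.

Hypothesis closedS : forall X Y Z, d2 (fundamental_form S) X Y Z = 0.

Lemma d_fundamental_form X Y Z :
  X (g Y (φ Z)) + Y (g Z (φ X)) + Z (g X (φ Y)) =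
  g [: X, Y :] (φ Z) + g [: Y, Z :] (φ X) + g [: Z, X :] (φ Y).
Proof.
have := closedS X Y Z; rewrite /d2 => /eqP; rewrite scaler_eq0 invr_eq0.
rewrite pnatr_eq0 /= /fundamental_form => /eqP E; apply/eqP; rewrite -subr_eq0.
by rewrite -[X in _ == X]E; apply/eqP; ring.
Qed.

(** For a second argument in the image of [φ], this is closedness of the fundamental form along [ξ]
    together with invariance of [φ]. In general [Y = η Y *: ξ - φ (φ Y)], and the part along [ξ] is
    the invariance of [η]. *)
Lemma xi_killing X Y : ξ (g X Y) = g [: ξ, X :] Y + g X [: ξ, Y :].
Proof.
have kphi Z T : ξ (g Z (φ T)) = g [: ξ, Z :] (φ T) + g Z [: ξ, φ T :].
  have := d_fundamental_form ξ Z T; rewrite phi_xi !scalar_form0 vfield0.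
  rewrite (metricC g ξ) metric_phil phi_xi scalar_form0 oppr0 vfield0 !addr0.
  move=> ->; rewrite bracket_xi_phi (bracketC T) metricNl.
  by rewrite (metricC g Z) metric_phil.
have -> : Y = η Y *: ξ - φ (φ Y).
  by rewrite phi_phi opprD opprK addrC subrK.
rewrite scalar_formB vfieldB kphi bracketDr !bracketNr bracketZr bracketXX.
rewrite !(scalar_formD, scalar_formN, metricZr, metric_xi, scaler0, vfieldM).
by rewrite scalar_form0 xi_eta; ring.
Qed.

End contact_structure.

(* Leaves a linear consequence [c = d] of [a = b] to [ring]. *)
Lemma eq_transport (V : zmodType) (a b c d : V) :
  a = b -> c - d = a - b -> c = d.
Proof. by move=> -> /eqP; rewrite subrr subr_eq0 => /eqP. Qed.

(** * Brackets and Lie derivatives in a 3-quasi-Sasakian triple *)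

Section three_structures.
Variables (R : realType) (m : nat) (M : manifold R m) (g : riemannian_metric M).
Local Notation C := (cinfty M).
Local Notation VF := (vfield M).
Implicit Types (A B G : almost_contact_metric g) (f h k : C) (X Y Z : VF).
Local Notation "[: X , Y :]" := (lie_bracket X Y) (at level 0).

Record even_relations A B G : Prop := EvenRelations {
  phi_comp : forall X, phi G X = phi A (phi B X) - eta B X *: xi A;
  phi_compN : forall X, phi G X = - phi B (phi A X) + eta A X *: xi B;
  phi_xir : phi A (xi B) = xi G;
  phi_xil : phi B (xi A) = - xi G;
  eta_phir : forall X, eta A (phi B X) = eta G X;
  eta_phil : forall X, eta B (phi A X) = - eta G X }.

(** Holding the relations for all three rotations makes every result available for the rotated
    triples by [quasi_triple_rot]. *)
Record quasi_triple A B G : Prop := QuasiTriple {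
  triple1 : even_relations A B G;
  triple2 : even_relations B G A;
  triple3 : even_relations G A B;
  triple_qs1 : quasi_sasakian A;
  triple_qs2 : quasi_sasakian B;
  triple_qs3 : quasi_sasakian G }.

Lemma quasi_triple_rot A B G : quasi_triple A B G -> quasi_triple B G A.
Proof. by case. Qed.

Lemma eta_xi_orth A B G : quasi_triple A B G ->
  (eta A (xi B) = 0) * (eta A (xi G) = 0).
Proof.
move=> t; split; last by rewrite -(phi_xir (triple1 t)) eta_phi.
by rewrite -[xi B]opprK -(phi_xil (triple3 t)) scalar_formN eta_phi oppr0.
Qed.

(** [eta B] is the metric dual of [xi B], and [xi A] is Killing. *)
Lemma lie_eta_metric A B X : quasi_sasakian A ->
  xi A (eta B X) - eta B [: xi A, X :] = g X [: xi A, xi B :].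
Proof.
by move=> [nA cA]; rewrite -!metric_xi (xi_killing nA cA) addrC addKr.
Qed.

Lemma dd_xil_metric A B X : quasi_sasakian A -> X (eta B (xi A)) = 0 ->
  dd (eta B) (xi A) X = g X [: xi A, xi B :].
Proof. by move=> qA o; rewrite -lie_eta_metric// /dd o subr0. Qed.

(** Closedness of the fundamental form of [B] at [(xi A, X, Y)]: its contraction with [xi A] is
    [eta G], and [xi A] is Killing. *)
Lemma dd_lie_phi A B G X Y : quasi_triple A B G ->
  dd (eta G) X Y = g X (lie_phi B (xi A) Y).
Proof.
case=> r _ _ [nA cA] [nB cB] _.
have := d_fundamental_form cB (xi A) X Y.
rewrite (xi_killing nA cA) (phi_xil r) !scalar_formN vfieldN !metric_xi.
rewrite (metricC g (xi A)) metric_xi (eta_phir r) (bracketC Y) metricNl.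
rewrite /dd /lie_phi scalar_formB (metricC g X (phi B _)) metric_phil => E.
by apply: (eq_transport (esym E)); ring.
Qed.

(** Contracting the fundamental form of [A] with [xi B] gives [- eta G], so both sides represent the
    same 2-form. *)
Lemma lie_phi_antisym A B G X : quasi_triple A B G ->
  lie_phi A (xi B) X = - lie_phi B (xi A) X.
Proof.
move=> t; apply: (metric_nondegenerate (g := g)) => Z.
rewrite scalar_formN -(dd_lie_phi _ _ t); case: t => r _ _ [nA cA] [nB cB] _.
have := d_fundamental_form cA (xi B) Z X.
rewrite (xi_killing nB cB) (phi_xir r) !metric_xi.
rewrite (metricC g (xi B)) metric_xi (eta_phil r) (bracketC X) metricNl.
rewrite /dd /lie_phi scalar_formB (metricC g Z (phi A _)) metric_phil vfieldN
  => E.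
by apply: (eq_transport E); ring.
Qed.

Lemma lie_phi_xi A B G : quasi_triple A B G -> lie_phi B (xi A) (xi G) = 0.
Proof.
move=> t; apply: (metric_nondegenerate (g := g)) => Z.
rewrite -(dd_lie_phi _ _ t) scalar_form0; case: t => _ _ _ _ _ [nG _].
exact: dd_xir.
Qed.

(** At maximal rank on a connected manifold, half of this function is the Sasakian constant. *)
Definition kappa A B G := eta G [: xi A, xi B :].

(** By [lie_phi_xi] for the triple [(B, G, A)] and [phi G (xi A) = xi B], the bracket is in the
    kernel of [phi G], hence a multiple of [xi G]. *)
Lemma bracket_xi A B G : quasi_triple A B G ->
  [: xi A, xi B :] = kappa A B G *: xi G.
Proof.
rewrite /kappa => /quasi_triple_rot t; have := lie_phi_xi t.
rewrite /lie_phi (phi_xir (triple2 t)) bracketXX sub0r => /eqP.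
rewrite oppr_eq0 => /eqP p0; have := phi_phi G [: xi B, xi A :].
rewrite p0 linear0 => /esym/eqP; rewrite addrC subr_eq0 => /eqP.
by rewrite (bracketC (xi B)) scalar_formN scaleNr => /oppr_inj ->.
Qed.

(** The Killing equation of [xi B] on the orthogonal pair [xi A], [xi G]. *)
Lemma kappa_rot A B G : quasi_triple A B G -> kappa B G A = kappa A B G.
Proof.
move=> t; have [nB cB] := triple_qs2 t.
have := xi_killing nB cB (xi A) (xi G).
rewrite !metric_xi (metricC g (xi A)) metric_xi.
rewrite (eta_xi_orth (quasi_triple_rot (quasi_triple_rot t))).1 vfield0.
rewrite (bracketC (xi B) (xi A)) scalar_formN => /esym/eqP.
by rewrite addrC subr_eq0 => /eqP.
Qed.

(** Lie derivative along [xi A] of the relation [phi_comp], in which [phi A] and [xi A] are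
    invariant. *)
Lemma lie_phi_left A B G X : quasi_triple A B G ->
  lie_phi A (xi G) X =
  - phi A (lie_phi B (xi A) X) + (kappa A B G * eta G X) *: xi A.
Proof.
move=> t; have t' := quasi_triple_rot (quasi_triple_rot t).
rewrite -[lie_phi A _ _]opprK -(lie_phi_antisym _ t').
have kE : kappa A B G * eta G X = xi A (eta B X) - eta B [: xi A, X :].
  by rewrite (lie_eta_metric _ _ (triple_qs1 t)) (bracket_xi t) metricZr
    metric_xi.
have [nA cA] := triple_qs1 t.
rewrite kE /lie_phi !(phi_comp (triple1 t)) bracketDr bracketNr bracketZr.
rewrite bracketXX scaler0 addr0 (bracket_xi_phi nA) phiB.
by apply: vfieldP => f; rewrite !(vfieldDE, vfieldNE, vfieldZE); ring.
Qed.

(** The same for [phi_compN], with [phi A] and [eta A] invariant. *)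
Lemma lie_phi_right A B G X : quasi_triple A B G ->
  lie_phi A (xi G) X =
  lie_phi B (xi A) (phi A X) - (kappa A B G * eta A X) *: xi G.
Proof.
move=> t; have t' := quasi_triple_rot (quasi_triple_rot t).
rewrite -[lie_phi A _ _]opprK -(lie_phi_antisym _ t').
have [nA cA] := triple_qs1 t.
rewrite /lie_phi !(phi_compN (triple1 t)) bracketDr bracketNr bracketZr.
rewrite (bracket_xi t) (bracket_xi_phi nA) (xi_eta nA).
by apply: vfieldP => f; rewrite !(vfieldDE, vfieldNE, vfieldZE); ring.
Qed.

(** [lie_phi G (xi B)] represents [dd (eta A)], and both [eta A] and the metric are invariant along
    [xi A]. *)
Lemma lie_phi_invariant A B G X : quasi_triple A B G ->
  [: xi A, lie_phi G (xi B) X :] = lie_phi G (xi B) [: xi A, X :].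
Proof.
move=> t; have t' := quasi_triple_rot t; have [nA cA] := triple_qs1 t.
apply: (metric_nondegenerate (g := g)) => Z.
have v0 Y : 0 = xi A (eta A Y) - eta A [: xi A, Y :].
  by rewrite (xi_eta nA) subrr.
have := dd_lie v0 Z X; rewrite !vfield0 !subr0 !(dd_lie_phi _ _ t').
rewrite (xi_killing nA cA) => E.
by apply: (eq_transport E); ring.
Qed.

(** Lie derivative along [xi A] of [lie_phi_left] for the triple [(B, G, A)], whose inner factor
    [lie_phi G (xi B)] is invariant. *)
Lemma lie_lie_phi A B G X : quasi_triple A B G ->
  [: xi A, lie_phi B (xi A) X :] - lie_phi B (xi A) [: xi A, X :] =
  - lie_phi B (xi A) (lie_phi G (xi B) X)
  + (xi A (kappa A B G) * eta A X) *: xi B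
  + (kappa A B G ^+ 2 * eta A X) *: xi G.
Proof.
move=> t; have t' := quasi_triple_rot t; have [nA cA] := triple_qs1 t.
have TG Y : lie_phi B (xi A) Y =
    - phi B (lie_phi G (xi B) Y) + (kappa A B G * eta A Y) *: xi B.
  by rewrite (lie_phi_left _ t') (kappa_rot t).
have p := lie_phi_invariant X t.
have q : [: xi A, phi B (lie_phi G (xi B) X) :] =
    lie_phi B (xi A) (lie_phi G (xi B) X) + phi B (lie_phi G (xi B) [: xi A,
      X :]).
  by rewrite -p /lie_phi subrK.
rewrite [lie_phi B (xi A) X]TG [lie_phi B (xi A) [: xi A, X :]]TG.
rewrite bracketDr bracketNr q bracketZr (bracket_xi t) vfieldM (xi_eta nA).
by apply: vfieldP => f; rewrite !(vfieldDE, vfieldNE, vfieldZE); ring.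
Qed.

(** A second computation of the same derivative: [lie_phi B (xi A)] represents [dd (eta G)], and the
    Lie derivative of [eta G] along [xi A] is [- kappa A B G * eta B]. *)
Lemma dd_lie_eta A B G X Y : quasi_triple A B G ->
  g X ([: xi A, lie_phi B (xi A) Y :] - lie_phi B (xi A) [: xi A, Y :]) =
  - kappa A B G * dd (eta B) X Y
  - X (kappa A B G) * eta B Y + Y (kappa A B G) * eta B X.
Proof.
move=> t; have t'' := quasi_triple_rot (quasi_triple_rot t).
have [nA cA] := triple_qs1 t.
have vE Z : - (kappa A B G * eta B Z) = xi A (eta G Z) - eta G [: xi A, Z :].
  rewrite (lie_eta_metric _ _ (triple_qs1 t)) (bracketC (xi A)) (bracket_xi
    t'').
  by rewrite -(kappa_rot t'') scalar_formN metricZr metric_xi.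
have := dd_lie vE X Y; rewrite !(dd_lie_phi _ _ t) !(vfieldN, vfieldM) => E.
rewrite scalar_formB; apply: (eq_transport E).
by rewrite (xi_killing nA cA) /dd; ring.
Qed.

Lemma kappa_eq A B G X Y : quasi_triple A B G ->
  - g X (lie_phi B (xi A) (lie_phi G (xi B) Y))
  + xi A (kappa A B G) * eta A Y * eta B X
  + kappa A B G ^+ 2 * eta A Y * eta G X =
  - kappa A B G * dd (eta B) X Y
  - X (kappa A B G) * eta B Y + Y (kappa A B G) * eta B X.
Proof.
move=> t; rewrite -(dd_lie_eta _ _ t) (lie_lie_phi _ t).
by rewrite !(scalar_formD, scalar_formN, metricZr, metric_xi).
Qed.

(** Put [X = xi B] in [kappa_eq]: the product of the two Lie derivatives drops out, being a multiple
    of [dd (eta A) (xi A) Y = 0]. *)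
Lemma d_kappa A B G Y : quasi_triple A B G ->
  Y (kappa A B G) = xi A (kappa A B G) * eta A Y + xi B (kappa A B G) * eta B Y.
Proof.
move=> t; have t' := quasi_triple_rot t; have t'' := quasi_triple_rot t'.
have [[nA _] [nB _]] := (triple_qs1 t, triple_qs2 t).
have := kappa_eq (xi B) Y t.
rewrite -(dd_lie_phi _ _ t) (dd_xil_metric (triple_qs2 t)); last first.
  by rewrite (eta_xi_orth t'').2 vfield0.
rewrite (bracket_xi t') metricZr metric_xi -(metric_xi A) (metricC g _ (xi A)).
rewrite -(dd_lie_phi _ _ t') (dd_xil nA) (dd_xil nB) eta_xi.
rewrite (eta_xi_orth t'').2 => E; apply: (eq_transport (esym E)); ring.
Qed.

(** [d_kappa] has no term along [xi G], so [kappa] is constant along the third field of the triple,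
    and by rotation along all three. *)
Lemma d_kappa0 A B G X : quasi_triple A B G -> X (kappa A B G) = 0.
Proof.
move=> t; have t' := quasi_triple_rot t; have t'' := quasi_triple_rot t'.
have xi0 A' B' G' : quasi_triple A' B' G' -> xi G' (kappa A' B' G') = 0.
  move=> u; rewrite (d_kappa _ u) (eta_xi_orth u).2.
  by rewrite (eta_xi_orth (quasi_triple_rot u)).1 !mulr0 addr0.
have xA : xi A (kappa A B G) = 0 by rewrite -(kappa_rot t); exact: xi0 t'.
have xB : xi B (kappa A B G) = 0 by rewrite (kappa_rot t''); exact: xi0 t''.
by rewrite (d_kappa _ t) xA xB !mul0r addr0.
Qed.

(** With [kappa] of zero derivative, substituting [lie_phi_right] into [kappa_eq] cancels the
    [kappa ^+ 2] terms and leaves [lie_phi B (xi A) Z = 0]. Both parts of [Z] have the same value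
    [kappa A B G * eta B Y] under [eta G]. *)
Lemma dd_kappa_null A B G X Y (Z :=
  lie_phi G (xi B) Y - kappa A B G *: phi A Y) :
  quasi_triple A B G -> dd (eta G) X Z = 0 /\ eta G Z = 0.
Proof.
move=> t; have t' := quasi_triple_rot t; have t'' := quasi_triple_rot t'.
split.
  have := kappa_eq X Y t; rewrite !(d_kappa0 _ t) (dd_lie_phi _ _ t'').
  rewrite (lie_phi_right _ t) (scalar_formB _ (lie_phi _ _ (phi A Y))) metricZr
    metric_xi => E.
  rewrite ddBr ddZr !(dd_lie_phi _ _ t).
  by apply: (eq_transport (esym E)); ring.
have [nA cA] := triple_qs1 t.
rewrite scalar_formB scalar_formZ (eta_phir (triple3 t)) -(metric_xi G).
rewrite metricC -(dd_lie_phi _ _ t') (dd_xil_metric (triple_qs3 t)); last first.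
  by rewrite (eta_xi_orth t).2 vfield0.
by rewrite (bracket_xi t'') metricZr metric_xi -(kappa_rot t'') subrr.
Qed.

End three_structures.

(** * Forms of top degree *)

Section alternating_forms.
Variables (R : realType) (m : nat) (M : manifold R m).
Local Notation C := (cinfty M).
Local Notation VF := (vfield M).
Implicit Types (f h : C) (X Y Z : VF) (x : M).

Definition replace k (Xs : 'I_k -> VF) j X : 'I_k -> VF :=
  fun i => if i == j then X else Xs i.

Definition multilinear_form k (w : kform M k) := forall Xs j f X Y,
  w (replace Xs j (f *: X + Y)) =
  f * w (replace Xs j X) + w (replace Xs j Y).

Lemma replace_comp k l (Xs : 'I_l -> VF) (s : 'I_k -> 'I_l) i X :
  injective s -> (fun j => replace Xs (s i) X (s j)) = replace (Xs \o s) i X.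
Proof.
by move=> s_inj; apply/funext => j; rewrite /replace (inj_eq s_inj).
Qed.

Lemma replace_notin k l (Xs : 'I_l -> VF) (s : 'I_k -> 'I_l) i X :
  (forall j, s j != i) -> (fun j => replace Xs i X (s j)) = Xs \o s.
Proof. by move=> si; apply/funext => j; rewrite /replace (negbTE (si j)). Qed.

(** In the summand of [s], slot [i] feeds exactly one of the two factors, according to the position
    of its preimage under [s]. *)
Lemma wedge_multilinear k l (w : kform M k) (t : kform M l) :
  multilinear_form w -> multilinear_form t -> multilinear_form (wedge w t).
Proof.
move=> mw mt Xs i f X Y; rewrite /wedge mul_scale -scalerDr mulr_sumr.
congr (_ *: _); rewrite -big_split /=; apply: eq_bigr => s _.
have [j ->] : exists j, i = s j by exists (s^-1%g i); rewrite permKV.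
have lr (a : 'I_k) (b : 'I_l) : s (lshift l a) != s (rshift k b).
  by rewrite (inj_eq perm_inj) eq_lrshift.
pose Xl a := Xs (s (lshift l a)); pose Xr b := Xs (s (rshift k b)).
case: (split_ordP j) => {j} j ->.
- have eXl Z : (fun a =>
    replace Xs (s (lshift l j)) Z (s (lshift l a))) = replace Xl j Z.
    by apply: (@replace_comp _ _ _ (fun a => s (lshift l a))) =>
      a b /perm_inj /lshift_inj.
  have eXr Z : (fun b => replace Xs (s (lshift l j)) Z (s (rshift k b))) = Xr.
    by apply: (@replace_notin _ _ _ (fun b => s (rshift k b))) => b;
      rewrite eq_sym.
  rewrite (eXl X) (eXl Y) (eXl (_ + _)) (eXr X) (eXr Y) (eXr (_ + _)).
  by rewrite mw mulrDl mulrDr -mulrA mulrCA.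
- have eXr Z : (fun b =>
    replace Xs (s (rshift k j)) Z (s (rshift k b))) = replace Xr j Z.
    by apply: (@replace_comp _ _ _ (fun b => s (rshift k b))) =>
      a b /perm_inj /rshift_inj.
  have eXl Z : (fun a => replace Xs (s (rshift k j)) Z (s (lshift l a))) = Xl.
    exact: (@replace_notin _ _ _ (fun a => s (lshift l a))).
  rewrite (eXl X) (eXl Y) (eXl (_ + _)) (eXr X) (eXr Y) (eXr (_ + _)) mt.
  by rewrite !mulrDr !(mulrCA _ f).
Qed.

(** Composing [s] with the transposition of [i] and [j] flips the sign and fixes the arguments, so
    the sum equals its own opposite. *)
Lemma wedge_alternating k l (w : kform M k) (t : kform M l) Xs i j :
  i != j -> Xs i = Xs j -> wedge w t Xs = 0.
Proof.
move=> ij Xij; rewrite /wedge; set F := BIG_F.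
have Xt a : Xs (tperm i j a) = Xs a by case: tpermP => [->|->|].
suff : \sum_s F s = - \sum_s F s.
  move=> /eqP; rewrite -addr_eq0 -mulr2n -scaler_nat scaler_eq0 pnatr_eq0 /=.
  by move=> /eqP ->; rewrite scaler0.
rewrite -sumrN (reindex_inj (mulIg (tperm i j))) /=; apply: eq_bigr => s _.
rewrite /F odd_permM odd_tperm ij signr_addb mulrN1 mulNr.
by under [X in w X]eq_fun do rewrite permM Xt;
  under [X in t X]eq_fun do rewrite permM Xt.
Qed.

(** The common kernel at [x] of [eta] and its exterior derivative. *)
Definition null_at (eta : {scalar VF}) x Z :=
  eta Z x = 0 /\ forall Y, dd eta Y Z x = 0.

Definition annihilates (P : VF -> Prop) k (w : kform M k) x :=
  forall Xs i, P (Xs i) -> w Xs x = 0.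

Lemma wedge_annihilates P k l (w : kform M k) (t : kform M l) x :
  annihilates P w x -> annihilates P t x -> annihilates P (wedge w t) x.
Proof.
move=> aw at_ Xs i Pi; rewrite /wedge.
rewrite cinftyZE; apply/eqP; rewrite mulf_eq0; apply/orP; right; apply/eqP.
elim/big_ind : _ => [//|f h f0 h0|s _]; first by rewrite cinftyDE f0 h0 addr0.
rewrite cinftyME; apply/eqP; rewrite mulf_eq0; apply/orP; right; apply/eqP.
rewrite cinftyME.
have : P (Xs (s (s^-1%g i))) by rewrite permKV.
case: (split_ordP (s^-1%g i)) => j -> Pj.
  by rewrite (aw _ j Pj) mul0r.
by rewrite (at_ _ j Pj) mulr0.
Qed.

Variable eta : {scalar VF}.
Local Notation top p :=
  (wedge (kform1 eta) (@wedge_pow _ _ _ 2 (kform2 (d1 eta)) p)).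

Lemma kform1_multilinear : multilinear_form (kform1 eta).
Proof.
by move=> Xs j f X Y; rewrite /kform1 /replace ord1 scalar_formD scalar_formZ.
Qed.

Lemma ddDr X Y Z : dd eta X (Y + Z) = dd eta X Y + dd eta X Z.
Proof. by rewrite -[Z in LHS]opprK ddBr -[- Z]scaleN1r ddZr mulN1r opprK. Qed.

Lemma d1_multilinear : multilinear_form (kform2 (d1 eta)).
Proof.
have lin X f Y Z : dd eta X (f *: Y + Z) = f * dd eta X Y + dd eta X Z.
  by rewrite ddDr ddZr.
move=> Xs j f X Y; rewrite /kform2 /replace.
case: (j =P 0) => [->|/eqP j0] /=.
  by rewrite !d1E !(ddC eta _ (Xs 1)) lin opprD scalerDr -mulrN mul_scale.
have -> : j = 1 by apply/val_inj; case: j j0 => -[|[]].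
by rewrite /= !d1E lin scalerDr mul_scale.
Qed.

Lemma wedge_pow_multilinear p : multilinear_form (@wedge_pow _ _ _ 2 (kform2
  (d1 eta)) p).
Proof.
elim: p => [Xs []//|p IH]; exact: wedge_multilinear d1_multilinear IH.
Qed.

Lemma wedge_pow_annihilates x p :
  annihilates (null_at eta x) (@wedge_pow _ _ _ 2 (kform2 (d1 eta)) p) x.
Proof.
elim: p => [Xs []//|p IH]; apply: wedge_annihilates IH => Xs j [_ n].
suff e : dd eta (Xs 0) (Xs 1) x = 0 by rewrite /kform2 d1E cinftyZE e mulr0.
case: (j =P 0) n => [->|/eqP j0] n; first by rewrite ddC cinftyNE n oppr0.
by have <- : j = 1 by apply/val_inj; case: j j0 n => -[|[]].
Qed.

Lemma top_annihilates x p : annihilates (null_at eta x) (top p) x.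
Proof.
apply: wedge_annihilates; last exact: wedge_pow_annihilates.
by move=> Xs j []; rewrite /kform1 ord1.
Qed.

End alternating_forms.

(** * Nondegeneracy at maximal rank *)

Section maximal_rank.
Variables (R : realType) (m : nat) (M : manifold R m).
Local Notation C := (cinfty M).
Local Notation VF := (vfield M).
Implicit Types (f h : C) (X Y Z W : VF) (x : M) (a c : R).

(* The coefficient of [E i] is [w ^ 2] times the derivative of [u i / w]: the
   functions [u i / w] are local coordinates where the bump function [w] does
   not vanish. *)
Definition frame_at x := exists (b w : C) (u : 'I_m -> C) (E : 'I_m -> VF),
  b x != 0 /\
  forall X, b *: X = \sum_i (w * X (u i) - u i * X w) *: E i.

Local Notation "c %:C" := (c *: (1 : C)) (at level 2).

Lemma multilinear_form_sum k (w : kform M k) (I : finType) Xs j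
    (F : I -> C) (Y : I -> VF) : multilinear_form w ->
  w (replace Xs j (\sum_i F i *: Y i)) = \sum_i F i * w (replace Xs j (Y i)).
Proof.
move=> mw; elim/big_rec2 : _ => [|i h X _ <-]; last exact: mw.
by have /eqP := mw Xs j 1 0 0;
  rewrite scaler0 addr0 mul1r -subr_eq subrr => /eqP.
Qed.

Lemma alternating_combination k (w : kform M k) Xs j (F : 'I_k -> C) :
  multilinear_form w ->
  (forall Ys i l, i != l -> Ys i = Ys l -> w Ys = 0) ->
  w (replace Xs j (\sum_i F i *: Xs i)) = F j * w Xs.
Proof.
move=> mw aw; rewrite multilinear_form_sum// (bigD1 j)//= big1 ?addr0 =>
  [|i ij].
  by congr (_ * w _); apply/funext => i; rewrite /replace; case: eqP => // ->.
by rewrite (aw _ i j) ?mulr0// /replace eqxx (negbTE ij).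
Qed.

(** Tangent vectors at [x] are encoded by rows [t X] of length [m]. If [t Z] is nonzero, a linear
    relation with the arguments of a nonzero value of the top form yields a null combination [W] of
    them, and putting [W] in one slot makes that value zero. *)
Lemma maximal_rank_null (eta : {scalar VF}) x Z :
  frame_at x -> has_rank eta m -> null_at eta x Z -> vanishes_at Z x.
Proof.
move=> [b [w [u [E [bx bE]]]]] [p [mE topx _]] Znull.
pose t X : 'rV[R]_m := \row_i (w * X (u i) - u i * X w) x.
(* Expand [b *: X] in the frame: the coefficients vanish at [x], while [b] does not. *)
have t0 X (l : VF -> C) : (forall f Y Y', l (f *: Y + Y') = f * l Y + l Y') ->
    t X = 0 -> l X x = 0.
  move=> ll tX; have l0 : l 0 = 0.
    by have /eqP := ll 1 0 0;
      rewrite scaler0 addr0 mul1r -subr_eq subrr => /eqP.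
  have lZ f Y : l (f *: Y) = f * l Y by have := ll f Y 0; rewrite l0 !addr0.
  apply: (mulfI bx); rewrite mulr0 -[LHS]/((b * l X) x) -lZ bE.
  elim/big_rec : _ => [|i Y _ IH]; first by rewrite l0.
  rewrite ll cinftyDE cinftyME IH addr0; move/rowP: tX => /(_ i).
  by rewrite !mxE => ->; rewrite mul0r.
have tD X Y : t (X + Y) = t X + t Y.
  apply/rowP => i; rewrite !mxE !(vfieldDE, cinftyDE, cinftyME, cinftyNE).
  by ring.
have tZ c X : t (c%:C *: X) = c *: t X.
  apply/rowP => i; rewrite !mxE !vfieldZE.
  by rewrite !(cinftyDE, cinftyME, cinftyNE, cinftyZE, cinfty1E); ring.
have t00 : t 0 = 0 by apply/rowP => i; rewrite !mxE !vfield0E !mulr0 subrr.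
have t_null X : t X = 0 -> null_at eta x X.
  move=> tX; split; first by apply: t0 tX => f Y Y';
    rewrite scalar_formD scalar_formZ.
  by move=> V; apply: (t0 _ (dd eta V)) tX => f Y Y'; rewrite ddDr ddZr.
have [//|Znz] := pselect (vanishes_at Z x).
have tZnz : t Z != 0.
  by apply/eqP => tZ0; apply: Znz => f; apply: (t0 _ (fun X => X f)) tZ0.
have [Xs] := topx x; pose T := \matrix_(i < 1 + p * 2) t (Xs i).
(* The [1 + p * 2 = m] rows of [T] and the row [t Z] are one too many to be independent. *)
have [v vA v0] : exists2 v : 'rV_(1 + p * 2 + 1),
    v *m col_mx T (t Z) = 0 & v != 0.
  have : kermx (col_mx T (t Z)) != 0.
    rewrite kermx_eq0 /row_free neq_ltn; apply/orP; left.
    rewrite (leq_ltn_trans (rank_leq_col _))//.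
    have -> : m = (1 + p * 2)%N by rewrite mE mulnC addnC.
    by rewrite addn1.
  by case/rowV0Pn => v /sub_kermxP vA v0; exists v.
set a := lsubmx v; set c := rsubmx v 0 0.
pose W := \sum_i (a 0 i)%:C *: Xs i.
have tW : t W + c *: t Z = 0.
  have tW : t W = a *m T.
    apply/rowP => j; rewrite !mxE.
    have -> : (w * W (u j) - u j * W w) x = t W 0 j by rewrite mxE.
    have -> : t W = \sum_i a 0 i *: t (Xs i).
      rewrite /W; elim/big_rec2 : _ => [|i X Y _ <-];
        [exact: t00|by rewrite tD tZ].
    rewrite summxE; apply: eq_bigr => i _; rewrite !mxE; ring.
  rewrite tW; have := vA; rewrite -[v]hsubmxK mul_row_col => <-.
  by rewrite (mx11_scalar (rsubmx v)) mul_scalar_mx.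
(* Otherwise the relation reduces to [c *: t Z = 0], which forces [v = 0]. *)
have [j aj] : exists j, a 0 j != 0.
  apply/existsP; apply: contraT; rewrite negb_exists => /forallP a0.
  have a00 : a = 0 by apply/rowP => j; rewrite [RHS]mxE; exact/eqP/negPn/a0.
  have := tW; rewrite /W a00 (eq_bigr (fun=> 0)); last first.
    by move=> i _; rewrite mxE scale0r scale0r.
  rewrite big1// t00 add0r.
  move=> /eqP; rewrite scaler_eq0 (negbTE tZnz) orbF => /eqP c0.
  move: v0; rewrite -[v]hsubmxK -/a a00 (mx11_scalar (rsubmx v)) -/c c0.
  by rewrite raddf0 row_mx0 eqxx.
have Wnull : null_at eta x W.
  have [e d] : null_at eta x (W + c%:C *: Z) by apply: t_null; rewrite tD tZ.
  split; first by have := e;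
    rewrite scalar_formD scalar_formZ cinftyDE cinftyME Znull.1 mulr0 addr0.
  by move=> Y; have := d Y;
    rewrite ddDr ddZr cinftyDE cinftyME Znull.2 mulr0 addr0.
move=> topXs; case: topXs.
have topm : multilinear_form (wedge (kform1 eta) (@wedge_pow _ _ _ 2 (kform2
  (d1 eta)) p)).
  by apply: wedge_multilinear;
    [exact: kform1_multilinear|exact: wedge_pow_multilinear].
(* The top form vanishes with [W] in slot [j], but equals [a 0 j] times its value on [Xs]. *)
have := @top_annihilates _ _ _ eta x p (replace Xs j W) j.
rewrite {1}/replace eqxx => /(_ Wnull).
rewrite (alternating_combination _ _ _ topm); last exact: wedge_alternating.
rewrite cinftyME cinftyZE cinfty1E mulr1 => /eqP.
by rewrite mulf_eq0 (negbTE aj) => /eqP.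
Qed.

End maximal_rank.

(** * Local frames *)

Section local_frame.
Variables (R : realType) (m : nat) (M : manifold R m).
Local Notation V := 'rV[R]_m.
Local Notation C := (cinfty M).
Local Notation VF := (vfield M).
Local Notation unit_vec i := (delta_mx 0 i : V).

Lemma vfield_sumE (I : Type) (s : seq I) (X : I -> VF) (f : C) :
  (\sum_(i <- s) X i) f = \sum_(i <- s) X i f.
Proof. by elim/big_rec2 : _ => [//|i Y h _ <-]; rewrite vfieldDE. Qed.

Lemma cinfty_sumE (I : Type) (s : seq I) (F : I -> C) (x : M) :
  (\sum_(i <- s) F i) x = \sum_(i <- s) F i x.
Proof. by elim/big_rec2 : _ => [//|i a f _ <-]; rewrite cinftyDE. Qed.

Lemma chart_ball (x0 : M) : exists c : chart R m M, exists r : R,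
  [/\ atlas c, chart_dom c x0, 0 < r &
    ball (chart_map c x0) (2 * r) `<=` chart_map c @` chart_dom c].
Proof.
have [c cM cx] := atlas_cover x0; exists c.
have : nbhs (chart_map c x0) (chart_map c @` chart_dom c).
  by apply: open_nbhs_nbhs; split; [exact: open_chart_image|exists x0].
move=> /nbhs_ballP[e /= e0 eim]; exists (e / 2); split=> //.
  by rewrite divr_gt0.
by rewrite mulrC divfK.
Qed.

Variables (c : chart R m M) (x0 : M) (r : R).
Hypotheses (cM : atlas c) (cx0 : chart_dom c x0) (r0 : 0 < r).
Local Notation q := (chart_map c x0).
Hypothesis ball_image : ball q (2 * r) `<=` chart_map c @` chart_dom c.
Implicit Types (f : C) (h : V -> R) (x : M).

Definition cut h := extend c (fun y => bump q r y * h y).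

Lemma cut_smooth h : smooth_on (ball q (2 * r)) h -> smooth (cut h).
Proof.
move=> sh; apply: extend_smooth ball_image _ _ => //.
  apply: smooth_onM => //; first exact: ball_open.
  exact/bump_smooth/ball_open.
by move=> y; rewrite mulf_eq0 => /norP[/bump_neq0].
Qed.

Lemma local_smooth f :
  smooth_on (chart_map c @` chart_dom c) (f \o chart_inv c).
Proof. by case: f => f fM /=; move/asboolP: fM; exact. Qed.

Lemma local_derivable f x v : chart_dom c x ->
  derivable (f \o chart_inv c) (chart_map c x) v.
Proof.
move=> cx; apply: diff_derivable.
by apply: smooth_on_differentiable (local_smooth f) _; exists x.
Qed.

Lemma cut_derive_smooth i f :
  cut ('D_(unit_vec i) (f \o chart_inv c)) \in @smooth_pred R m M.
Proof.
apply/asboolP/cut_smooth/smooth_on_derive.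
exact: smooth_on_sub ball_image (local_smooth f).
Qed.

Definition frame_fun i f : C := Cinfty (cut_derive_smooth i f).

Lemma cutE h x : chart_dom c x ->
  cut h x = bump q r (chart_map c x) * h (chart_map c x).
Proof. by move=> cx; rewrite /cut /extend asboolT. Qed.

Lemma cut_out h x : ~ chart_dom c x -> cut h x = 0.
Proof. by move=> cx; rewrite /cut /extend asboolF. Qed.

Fact frame_linear i : linear (frame_fun i).
Proof.
move=> a f h; apply: cinftyP => x; rewrite cinftyDE cinftyZE /=.
have [cx|cx] := pselect (chart_dom c x); last by rewrite !cut_out// mulr0 addr0.
rewrite !cutE//.
have -> : 'D_(unit_vec i) ((a *: f + h : C) \o chart_inv c) (chart_map c x) =
    a * 'D_(unit_vec i) (f \o chart_inv c) (chart_map c x) +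
    'D_(unit_vec i) (h \o chart_inv c) (chart_map c x).
  have df := local_derivable (f := f) (v := unit_vec i) cx.
  have dh := local_derivable (f := h) (v := unit_vec i) cx.
  have := deriveD (derivableZ (k := a) df) dh.
  by rewrite deriveZ.
by ring.
Qed.

Fact frame_mul i (f h : C) :
  frame_fun i (f * h) = f * frame_fun i h + h * frame_fun i f.
Proof.
apply: cinftyP => x; rewrite cinftyDE !cinftyME /=.
have [cx|cx] := pselect (chart_dom c x);
  last by rewrite !cut_out// !mulr0 addr0.
rewrite !cutE//.
have -> : 'D_(unit_vec i) ((f * h : C) \o chart_inv c) (chart_map c x) =
    f x * 'D_(unit_vec i) (h \o chart_inv c) (chart_map c x) +
    h x * 'D_(unit_vec i) (f \o chart_inv c) (chart_map c x).
  have df := local_derivable (f := f) (v := unit_vec i) cx.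
  have dh := local_derivable (f := h) (v := unit_vec i) cx.
  have := deriveM df dh.
  by rewrite /= (chart_mapK (mem_set cx)).
by ring.
Qed.

(** The coordinate field times the bump function, hence defined on all of [M]. *)
Definition frame_field i : VF := VField (@frame_linear i) (@frame_mul i).

Lemma cut_one_smooth : cut (cst 1) \in @smooth_pred R m M.
Proof. by apply/asboolP/cut_smooth; exact: smooth_on_cst. Qed.

Lemma cut_coord_smooth i : cut (fun y => y 0 i) \in @smooth_pred R m M.
Proof. by apply/asboolP/cut_smooth; exact: smooth_on_coord. Qed.

Let w : C := Cinfty cut_one_smooth.
Let u i : C := Cinfty (cut_coord_smooth i).

Let w_out x : ~ chart_dom c x -> w x = 0. Proof. exact: cut_out. Qed.
Let wE x : chart_dom c x -> w x = bump q r (chart_map c x).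
Proof. by move=> cx; rewrite /w /= cutE// mulr1. Qed.
Let uE x i : chart_dom c x -> u i x = w x * chart_map c x 0 i.
Proof. by move=> cx; rewrite wE//; exact: cutE. Qed.

Let bump_ball y : bump q r y != 0 -> ball q (2 * r) y.
Proof.
move=> /bump_neq0 b; split; first by rewrite mulr_gt0.
move=> i j; rewrite ord1 /ball /= distrC (lt_trans (b j))//.
by rewrite mulr_natl mulr2n ltrDl.
Qed.

(** Apply [X] to [decomp] and evaluate at [x]: the terms with [X (w * w)] cancel, the factors
    [u i - p 0 i *: w] vanish, and [H i] becomes a partial derivative times [w x]. *)
Let frame_expansion (X : VF) f x : w x != 0 ->
  w x ^+ 2 * X f x = \sum_i (X (u i) x - chart_map c x 0 i * X w x) *
    (w x * 'D_(unit_vec i) (f \o chart_inv c) (chart_map c x)).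
Proof.
move=> wx0; have cx : chart_dom c x.
  by apply: contrapT => /w_out /eqP; apply/negP.
set p := chart_map c x; set F := f \o chart_inv c.
have Bp : ball q (2 * r) p by apply: bump_ball; rewrite -wE.
have sF : smooth_on (ball q (2 * r)) F :=
  smooth_on_sub ball_image (local_smooth f).
pose h i := segment_mean 0 ('D_(unit_vec i) F) p.
have hM i : cut (h i) \in @smooth_pred R m M.
  by apply/asboolP/cut_smooth/segment_mean_smooth => //;
    exact: smooth_on_derive.
pose H i : C := Cinfty (hM i).
have HE i z : chart_dom c z -> H i z = w z * h i (chart_map c z).
  by move=> cz; rewrite wE//= cutE.
(* Hadamard's formula times [w * w], which makes it an identity in C^oo(M), trivial where [w]
   vanishes. *)
have decomp : f * (w * w) =
    f x *: (w * w) + \sum_i (u i - p 0 i *: w) * H i.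
  apply: cinftyP => z; rewrite cinftyDE cinftyZE !cinftyME cinfty_sumE.
  have [cz|cz] := pselect (chart_dom c z); last first.
    rewrite w_out// !mulr0 big1 ?addr0// => i _.
    by rewrite cinftyME [H i z]cut_out// mulr0.
  have [wz0|wz0] := eqVneq (w z) 0.
    rewrite wz0 !mulr0 big1 ?addr0// => i _.
    by rewrite cinftyME HE// wz0 mul0r mulr0.
  have Bz : ball q (2 * r) (chart_map c z) by apply: bump_ball; rewrite -wE.
  have FE t : chart_dom c t -> F (chart_map c t) = f t.
    by move=> ct; rewrite /F /= (chart_mapK (mem_set ct)).
  have /eqP := hadamard sF Bp Bz.
  rewrite (FE z cz) (FE x cx) subr_eq => /eqP ->; rewrite mulrDl addrC.
  congr (_ + _).
  rewrite mulr_suml; apply: eq_bigr => i _.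
  rewrite cinftyME cinftyDE cinftyNE cinftyZE HE// uE// -/(h i _).
  by ring.
have /(congr1 (fun k : C => k x)) := congr1 X decomp.
rewrite vfieldM vfieldD !cinftyDE !cinftyME vfieldZ cinftyZE.
rewrite vfield_sum cinfty_sumE => /addrI E.
rewrite expr2 E; apply: eq_bigr => i _.
rewrite vfieldM cinftyDE !cinftyME cinftyDE cinftyNE cinftyZE uE// -/p.
rewrite HE// /h segment_mean_base vfieldB vfieldZ cinftyDE cinftyNE cinftyZE.
by ring.
Qed.

Lemma frame_at_center : frame_at x0.
Proof.
(* Two factors [w] come from [frame_expansion]; the third turns the chart coordinates into the
   global functions [u i]. *)
exists (w * w * w), w, u, frame_field; split.
  have w0 : w x0 != 0.
    by rewrite wE// gt_eqF// bump_gt0// => i; rewrite subrr normr0.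
  by rewrite !cinftyME !mulf_neq0.
move=> X; apply: vfieldP => f; apply: cinftyP => x.
rewrite vfield_sumE cinfty_sumE vfieldZE !cinftyME.
have [wx0|wx0] := eqVneq (w x) 0.
  rewrite wx0 !mul0r big1// => i _; rewrite vfieldZE cinftyME.
  have -> : frame_field i f x = 0; last by rewrite mulr0.
  have [cx|cx] := pselect (chart_dom c x); last by rewrite /= cut_out.
  by rewrite /= cutE// -wE// wx0 mul0r.
have cx : chart_dom c x by apply: contrapT => /w_out /eqP; apply/negP.
have -> : w x * w x * w x * X f x = w x * (w x ^+ 2 * X f x) by ring.
rewrite frame_expansion// mulr_sumr; apply: eq_bigr => i _.
have -> : (w x * 'D_(unit_vec i) (f \o chart_inv c) (chart_map c x)) =
    frame_field i f x by rewrite wE//; apply/esym; exact: cutE.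
rewrite vfieldZE !(cinftyME, cinftyDE, cinftyNE) uE//.
by ring.
Qed.

(** Testing against the frame fields kills the partial derivatives near the center, hence the
    coefficients in Hadamard's formula. *)
Lemma locally_constant f : (forall X : VF, X f = 0) ->
  \forall x \near x0, f x = f x0.
Proof.
move=> Xf; have rr : ball q r `<=` ball q (2 * r).
  by apply: le_ball; rewrite mulr_natl mulr2n lerDl ltW.
have sF := smooth_on_sub (subset_trans rr ball_image) (local_smooth f).
have Df i y : ball q r y -> 'D_(unit_vec i) (f \o chart_inv c) y = 0.
  move=> By; have [x cx xy] := ball_image (rr y By).
  have := congr1 (fun k : C => k x) (Xf (frame_field i)).
  rewrite /= cutE// xy => /eqP; rewrite mulf_eq0 => /orP[|/eqP//].
  rewrite gt_eqF// bump_gt0// => j; rewrite distrC.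
  by case: By => _ /(_ 0 j).
have : nbhs x0 (chart_dom c `&` chart_map c @^-1` ball q r).
  apply: filterI; first by apply: open_nbhs_nbhs; split => //;
    exact: open_chart_dom.
  by apply: (continuous_chart_map (mem_set cx0)); exact: nbhsx_ballx.
apply: filterS => x [cx Bx].
have Bq : ball q r q by exact: ballxx.
have := hadamard sF Bq Bx; rewrite /= !chart_mapK ?mem_set// big1 => [|i _].
  by move/eqP; rewrite subr_eq0 => /eqP.
rewrite /segment_mean (@eq_integral01 _ _ (fun=> 0)) ?integral01_cst ?mulr0//.
by move=> t t01; rewrite Df ?mulr0//; exact: segment_ball.
Qed.

End local_frame.

Lemma frame_everywhere (R : realType) (m : nat) (M : manifold R m) (x : M) :
  frame_at x.
Proof.
by have [c [r [cM cx r0 im]]] := chart_ball x; exact: frame_at_center im.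
Qed.

(** The level set of [f y] is open and closed. *)
Lemma connected_constant (R : realType) (m : nat) (M : manifold R m)
    (f : cinfty M) : connected [set: M] ->
  (forall X : vfield M, X f = 0) -> forall x y, f x = f y.
Proof.
move=> conM Xf x y.
have loc z : \forall t \near z, f t = f z.
  by have [c [r [cM cz r0 im]]] := chart_ball z;
    exact: locally_constant im _ Xf.
have oS (P : set R) : open [set z | P (f z)].
  by rewrite openE => z Pz; apply: filterS (loc z) => t /= ->.
have -> // : [set z | f z = f y] = setT -> f x = f y by move=> /seteqP[_ /(_
  x)]; exact.
apply: conM.
- by exists y.
- by exists [set z | f z = f y]; [exact: (oS [set a | a = f y])|rewrite setTI].
- exists [set z | f z = f y]; last by rewrite setTI.
  by rewrite -openC; exact: (oS [set a | a <> f y]).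
Qed.

(** * 3-quasi-Sasakian structures of maximal rank *)

Section maximal_rank_structures.
Variables (R : realType) (m : nat) (M : manifold R m) (g : riemannian_metric M).
Implicit Types (A B G : almost_contact_metric g) (S : 'I_3 ->
  almost_contact_metric g).
Local Notation VF := (vfield M).
Implicit Types X Y Z : VF.

Lemma vanishes_everywhere Z : (forall x, vanishes_at Z x) -> Z = 0.
Proof. by move=> Z0; apply: vfieldP => f; apply: cinftyP => x; exact: Z0. Qed.

Lemma maximal_rank_nondegenerate (eta : {scalar VF}) Z :
  has_rank eta m -> eta Z = 0 -> (forall Y, dd eta Y Z = 0) -> Z = 0.
Proof.
move=> rk eZ dZ; apply: vanishes_everywhere => x.
apply: maximal_rank_null (frame_everywhere x) rk _.
by split=> [|Y]; rewrite ?eZ ?dZ.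
Qed.

(** The field of [dd_kappa_null] must vanish, so [lie_phi G (xi B)] is [kappa A B G] times
    [phi A]. *)
Lemma dd_kappa A B G X Y : quasi_triple A B G -> has_rank (eta G) m ->
  dd (eta A) X Y = kappa A B G * fundamental_form A X Y.
Proof.
move=> t rkG; have t' := quasi_triple_rot t.
have : lie_phi G (xi B) Y - kappa A B G *: phi A Y = 0.
  apply: maximal_rank_nondegenerate rkG (dd_kappa_null 0 Y t).2 _ => Z.
  exact: (dd_kappa_null Z Y t).1.
move=> /eqP; rewrite subr_eq0 => /eqP TE.
by rewrite (dd_lie_phi _ _ t') TE metricZr.
Qed.

(** Modulo 3, translation by [i] is the square of translation by [i + i]. *)
Lemma cyclic_perm_even (i : 'I_3) : ~~ odd_perm (perm (addrI i)).
Proof.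
have -> : perm (addrI i) = (perm (addrI (i + i)) * perm (addrI (i + i)))%g.
  apply/permP => j; rewrite permM !permE; apply/val_inj.
  by case: i j => [[|[|[|]]] //= ?] [[|[|[|]]] //= ?].
by rewrite odd_permM addbb.
Qed.

Lemma three_quasi_triple S : three_quasi_sasakian S ->
  forall i, quasi_triple (S i) (S (i + 1)) (S (i + 2)).
Proof.
move=> [c3 qs] i.
have rel (j : 'I_3) : even_relations (S j) (S (j + 1)) (S (j + 2)).
  have := c3 _ (cyclic_perm_even j); rewrite /= !permE addr0.
  move=> [p1 p2 [p3 p4] p5 p6]; split=> //; first by rewrite p4 opprK.
  by move=> X; rewrite p6 opprK.
have [i11 i12 i21 i22] : [/\ i + 1 + 1 = i + 2, i + 1 + 2 = i, i + 2 + 1 = i &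
    i + 2 + 2 = i + 1].
  by case: i => [[|[|[|]]] //= ?]; split; apply/val_inj.
split=> //.
  by have := rel (i + 1); rewrite i11 i12.
by have := rel (i + 2); rewrite i21 i22.
Qed.

Lemma kappa_shift S : three_quasi_sasakian S -> forall i,
  kappa (S i) (S (i + 1)) (S (i + 2)) = kappa (S 0) (S 1) (S 2).
Proof.
move=> qS; have t := three_quasi_triple qS 0.
have t' := quasi_triple_rot t; have t'' := quasi_triple_rot t'.
have e1 : (0 : 'I_3) + 1 = 1 by apply/val_inj.
have e2 : (0 : 'I_3) + 2 = 2 by apply/val_inj.
rewrite e1 e2 in t t' t''.
move=> i; have /or3P[/eqP->|/eqP->|/eqP->] : [|| i == 0, i == 1 | i == 2].
    by case: i => [[|[|[|]]]].
- by rewrite e1 e2.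
- have -> : (1 : 'I_3) + 1 = 2 by apply/val_inj.
  have -> : (1 : 'I_3) + 2 = 0 by apply/val_inj.
  exact: kappa_rot.
- have -> : (2 : 'I_3) + 1 = 0 by apply/val_inj.
  have -> : (2 : 'I_3) + 2 = 1 by apply/val_inj.
  by rewrite (kappa_rot t'').
Qed.

End maximal_rank_structures.

Theorem corollary4p4 (R : realType) (n : nat) (M : manifold R (4 * n + 3))
    (g : riemannian_metric M) (S : 'I_3 -> almost_contact_metric g) :
  connected [set: M]%classic ->
  three_quasi_sasakian S ->
  three_rank S (4 * n + 3) ->
  exists a : R, three_alpha_sasakian a S.
Proof.
move=> conM qS rkS; have t i := three_quasi_triple qS i.
have [[x0 _]|noM] := pselect (exists x : M, True); last first.
  (* On an empty manifold all functions are equal, so any nonzero constant serves. *)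
  exists 1; split; first exact: qS.1.
  move=> i; split; [exact: oner_neq0|exact: (qS.2 i).1|].
  by move=> X Y; apply: cinftyP => x; case: noM; exists x.
pose k := kappa (S 0) (S 1) (S 2).
have kE : k = k x0 *: (1 : cinfty M).
  apply: cinftyP => x; rewrite cinftyZE cinfty1E mulr1.
  apply: connected_constant => // X; rewrite /k -(kappa_shift qS 0).
  exact: d_kappa0 (t 0).
have ddk i X Y : dd (eta (S i)) X Y = k x0 *: fundamental_form (S i) X Y.
  rewrite (dd_kappa _ _ (t i) (rkS _)) (kappa_shift qS i) -/k kE.
  by apply: cinftyP => x; rewrite cinftyME !cinftyZE cinfty1E mulr1.
(* The half is the normalization of [d1]. *)
exists (2^-1 * k x0); split; first exact: qS.1.
move=> i; split; [|exact: (qS.2 i).1|by move=> X Y; rewrite d1E ddk scalerA].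
rewrite mulf_neq0 ?invr_eq0 ?pnatr_eq0//; apply/eqP => k0.
(* With [k x0 = 0] the form [eta (S i)] is closed and kills [xi (S (i + 1))]; nondegeneracy then
   contradicts [eta_xi]. *)
have xi0 : xi (S (i + 1)) = 0.
  apply: maximal_rank_nondegenerate (rkS i) (eta_xi_orth (t i)).1 _ => Y.
  by rewrite ddk k0 scale0r.
have := eta_xi (S (i + 1)); rewrite xi0 scalar_form0.
move=> /(congr1 (fun f : cinfty M => f x0)) /esym/eqP.
by rewrite cinfty1E oner_eq0.
Qed.
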